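(* Let $s\in I(\Phi)$ belong to the Weyl group $W(\Phi)$. Then there is $\sigma\in\mathrm{Inv}^\tau_s(\mathfrak g_{\mathbb R},\mathfrak h_{\mathbb R})$ such that the real Lie algebra $\mathfrak g_\sigma$ is isomorphic to the split real form $\mathfrak g_{\mathbb R}$.
   Context: $\mathfrak g$ is a complex semisimple Lie algebra, $\mathfrak h$ a Cartan subalgebra, $\Phi=\Phi(\mathfrak g,\mathfrak h)$, $\mathfrak h_{\mathbb R}=\{H\in\mathfrak h:\alpha(H)\in\mathbb R\ \forall\alpha\}$; the Killing form gives an inner product on $\mathfrak h_{\mathbb R}$ and on $V=\mathfrak h_{\mathbb R}^*$, in which $\Phi$ is a root system; $W(\Phi)$ is its Weyl group and $I(\Phi)$ the set of orthogonal involutions of $V$ preserving $\Phi$. Fix a Chevalley system $\{(X_\alpha,H_\alpha)\}$: $X_\alpha\in\mathfrak g^\alpha$, $H_\alpha\in\mathfrak h_{\mathbb R}$, $\alpha(H_\beta)\in\mathbb Z$, $[X_\alpha,X_{-\alpha}]=-H_\alpha$, $[H_\alpha,X_{\pm\alpha}]=\pm2X_{\pm\alpha}$, with $\mathfrak g_{\mathbb R}=\mathfrak h_{\mathbb R}\oplus\bigoplus_\alpha\mathbb RX_\alpha$ a split real form and $\tau$ ($\tau|_{\mathfrak h_{\mathbb R}}=-\mathrm{id}$, $\tau X_\alpha=X_{-\alpha}$) an involutive automorphism of $\mathfrak g_{\mathbb R}$; $\mathfrak g_u=\{X\in\mathfrak g_{\mathbb R}:\tau X=X\}\oplus i\{X\in\mathfrak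 g_{\mathbb R}:\tau X=-X\}$. Automorphisms of $\mathfrak g_{\mathbb R}$ are extended anti-$\mathbb C$-linearly to $\mathfrak g$. $\mathrm{Inv}^\tau(\mathfrak g_{\mathbb R},\mathfrak h_{\mathbb R})$ is the set of involutive automorphisms $\sigma$ of $\mathfrak g_{\mathbb R}$ with $\sigma(\mathfrak h_{\mathbb R})=\mathfrak h_{\mathbb R}$ and $\sigma(\mathfrak g_u)=\mathfrak g_u$; for such $\sigma$, $\rho(\sigma)\in I(\Phi)$ is $\alpha\mapsto\alpha\circ\sigma^{-1}|_{\mathfrak h_{\mathbb R}}$, and $\mathrm{Inv}^\tau_s(\mathfrak g_{\mathbb R},\mathfrak h_{\mathbb R})=\{\sigma:\rho(\sigma)=s\}$. For such $\sigma$, $\mathfrak g_\sigma=\{X\in\mathfrak g_{\mathbb R}:\sigma X=X\}\oplus i\{X\in\mathfrak g_{\mathbb R}:\sigma X=-X\}$, a real form of $\mathfrak g$. *)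

(* Defs.v *)
From HB Require Import structures.
From mathcomp Require Import all_boot all_order all_algebra.
From mathcomp Require Import reals.
Set Implicit Arguments. Unset Strict Implicit. Unset Printing Implicit Defensive.
Import Order.TTheory GRing.Theory Num.Theory.
Local Open Scope ring_scope.

(* Data: the split real form g_R of g is a finite dimensional real Lie algebra
   (L, br); g = g_R (x) C is represented by pairs (X, Y) meaning X + iY. *)
Section Lie.
Variables (R : realType) (L : vectType R) (br : L -> L -> L).

Definition lie_algebra : Prop :=
  [/\ forall a x y z, br (a *: x + y) z = a *: br x z + br y z,
      forall a x y z, br z (a *: x + y) = a *: br z x + br z y,
      forall x, br x x = 0 &
      forall x y z, br x (br y z) + br y (br z x) + br z (br x y) = 0].

Definition bracket_span (U V : {vspace L}) : {vspace L} :=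
  <<[seq br u v | u <- vbasis U, v <- vbasis V]>>%VS.

Definition is_ideal (I : {vspace L}) : Prop :=
  forall x y, x \in I -> br y x \in I.

Definition solvable_sub (I : {vspace L}) : Prop :=
  exists n, iter n (fun J => bracket_span J J) I = 0%VS.

Definition semisimple : Prop :=
  forall I, is_ideal I -> solvable_sub I -> I = 0%VS.

Definition subalgebra (h : {vspace L}) : Prop :=
  forall x y, x \in h -> y \in h -> br x y \in h.

Definition nilpotent_sub (h : {vspace L}) : Prop :=
  exists n, iter n (fun J => bracket_span h J) h = 0%VS.

Definition cartan (h : {vspace L}) : Prop :=
  [/\ subalgebra h, nilpotent_sub h &
      forall x, (forall y, y \in h -> br x y \in h) -> x \in h].

Definition functional (h : {vspace L}) := 'Hom(subvs_of h, R^o).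

Definition ev (h : {vspace L}) (a : functional h) (x : L) : R := a (vsproj h x).

Definition root_space (h : {vspace L}) (a : functional h) (x : L) : Prop :=
  forall H, H \in h -> br H x = ev a H *: x.

Definition is_root (h : {vspace L}) (a : functional h) : Prop :=
  a != 0 /\ exists x, x != 0 /\ root_space a x.

Definition ad (x : L) : 'End(L) := linfun (br x).
Definition killing (x y : L) : R :=
  \tr (passmx.mxof (vbasis {:L}) (vbasis {:L}) (ad x \o ad y)%VF).

(* inner product on V = h_R^* induced by the Killing form on h_R:
   coordinates on a basis of h_R and the inverse Gram matrix *)
Definition gram (h : {vspace L}) : 'M[R]_(\dim h) :=
  \matrix_(i, j) killing (tnth (vbasis h) i) (tnth (vbasis h) j).
Definition coords (h : {vspace L}) (a : functional h) : 'rV[R]_(\dim h) :=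
  \row_i ev a (tnth (vbasis h) i).
Definition inner (h : {vspace L}) (a b : functional h) : R :=
  (coords a *m invmx (gram h) *m (coords b)^T) 0 0.

Definition refl (h : {vspace L}) (a l : functional h) : functional h :=
  l - (2 * inner l a / inner a a) *: a.

Definition in_weyl (h : {vspace L}) (s : 'End(functional h)) : Prop :=
  exists rs : seq (functional h), (forall a, a \in rs -> is_root a) /\
    forall l, s l = foldr (fun a f => refl a \o f) id rs l.

Definition in_I (h : {vspace L}) (s : 'End(functional h)) : Prop :=
  [/\ forall l, s (s l) = l,
      forall a b, inner (s a) (s b) = inner a b &
      forall a, is_root a <-> is_root (s a)].

Definition automorphism (f : 'End(L)) : Prop :=
  bijective f /\ forall x y, f (br x y) = br (f x) (f y).

Definition chevalley (h : {vspace L}) (X Hc : functional h -> L) (tau : 'End(L)) : Prop :=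
  [/\ (forall a, is_root a -> X a != 0 /\ root_space a (X a)) /\
      (forall a, is_root a -> Hc a \in h),
      forall a b : functional h, is_root a -> is_root b -> exists z : int, ev a (Hc b) = z%:~R,
      forall a, is_root a -> br (X a) (X (- a)) = - Hc a,
      (forall a, is_root a ->
        br (Hc a) (X a) = 2 *: X a /\ br (Hc a) (X (- a)) = - (2 *: X (- a))) /\
      (forall U : {vspace L}, (h <= U)%VS ->
          (forall a, is_root a -> X a \in U) -> U = fullv) &
      [/\ automorphism tau, forall x, tau (tau x) = x,
          forall H, H \in h -> tau H = - H &
          forall a, is_root a -> tau (X a) = X (- a)]].

Definition brC (p q : L * L) : L * L :=
  (br p.1 q.1 - br p.2 q.2, br p.1 q.2 + br p.2 q.1).

(* g_f = {X in g_R : f X = X} + i {X in g_R : f X = - X}; g_u = g_tau *)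
Definition real_form (f : 'End(L)) (p : L * L) : Prop :=
  f p.1 = p.1 /\ f p.2 = - p.2.

(* anti-C-linear extension of f to g *)
Definition extC (f : 'End(L)) (p : L * L) : L * L := (f p.1, - f p.2).

Definition inv_tau (h : {vspace L}) (tau sigma : 'End(L)) : Prop :=
  [/\ automorphism sigma, forall x, sigma (sigma x) = x,
      (sigma @: h)%VS = h &
      forall q, real_form tau q <-> exists p, real_form tau p /\ extC sigma p = q].

Definition rho_eq (h : {vspace L}) (sigma : 'End(L)) (s : 'End(functional h)) : Prop :=
  forall a H, H \in h -> ev (s a) H = ev a ((sigma^-1)%VF H).

Definition iso_to_split (sigma : 'End(L)) : Prop :=
  exists f1 f2 : 'End(L),
    let phi x := (f1 x, f2 x) in
    [/\ injective phi, forall x, real_form sigma (phi x),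
        forall p, real_form sigma p -> exists x, phi x = p &
        forall x y, phi (br x y) = brC (phi x) (phi y)].

End Lie.

(* Main.v *)
Require Import Defs.
From HB Require Import structures.
From mathcomp Require Import all_boot all_order all_algebra.
From mathcomp Require Import boolp reals.
From mathcomp Require Import zify ring lra.
Set Implicit Arguments. Unset Strict Implicit. Unset Printing Implicit Defensive.
Import Order.TTheory GRing.Theory Num.Theory.
Local Open Scope ring_scope.

(** The involution s is a product of reflections in pairwise strongly orthogonal
    roots g_1, ..., g_k: unless it is trivial it negates a root (otherwise it fixes
    a regular vector), and one splits off a longest negated root and repeats.

    There is a coweight lam with all g_i(lam) odd.  This is a linear system over
    F_2, solvable unless 2 x = sum_i d_i g_i with sum_i d_i odd for some x in the
    lattice of the roots negated by s; since d_i = <x, g_i^v>, it suffices that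
    sum_i <a, g_i^v> is even for each root a negated by s, which is read off from
    4 = sum_i <a, g_i^v><g_i, a^v> and strong orthogonality.

    Conjugating lam by the Cayley transforms of the commuting sl_2's of the g_i
    gives E = H' + sum_i g_i(lam)/2 (X_{g_i} - X_{-g_i}) with g_i(H') = 0.  Then
    ad E is diagonalizable with integer eigenvalues and tau E = - E.  The
    involution sigma = (-1)^(ad E) commutes with tau and acts on h as s, and
    i^(ad E) maps g_R isomorphically onto g_sigma. *)

(** * Finite sequences, linear systems and parity *)

Lemma sub_count_ltn (T : eqType) (p q : pred T) (s : seq T) (x : T) :
  subpred p q -> x \in s -> q x -> ~~ p x -> (count p s < count q s)%N.
Proof.
move=> pq xs qx npx; rewrite -(size_filter q) -(count_predC p) !count_filter.
have /eq_count -> : predI p q =1 p by move=> y /=; apply/andb_idr/pq.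
by rewrite -addn1 leq_add2l -has_count; apply/hasP; exists x; rewrite //= npx.
Qed.

Lemma seq_lt_ind (d : Order.disp_t) (T : eqType) (O : porderType d) (f : T -> O)
    (s : seq T) (P : T -> Prop) :
  {in s, forall x, {in s, forall y, (f y < f x)%O -> P y} -> P x} ->
  {in s, forall x, P x}.
Proof.
move=> step x; have [n] := ubnP (count (fun y => f y < f x)%O s).
elim: n x => // n IHn x; rewrite ltnS => le_x_n xs; apply: step => // y ys yx.
apply: IHn (ys); apply: leq_trans le_x_n.
by apply: (sub_count_ltn _ ys yx) => [z zy|]; rewrite ?ltxx // (lt_trans zy).
Qed.

Lemma seq_argmax (d : Order.disp_t) (T : eqType) (O : orderType d) (f : T -> O)
    (s : seq T) (x0 : T) :
  x0 \in s -> exists2 x, x \in s & {in s, forall y, (f y <= f x)%O}.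
Proof.
rewrite -index_mem => lt_x0.
have [i _ max_i] := arg_maxP (fun i : 'I_(size s) => f (nth x0 s i))
  (erefl : xpredT (Ordinal lt_x0)).
exists (nth x0 s i) => [|y ys]; first exact: mem_nth.
by have:= ys; rewrite -index_mem => lt_y; have := max_i (Ordinal lt_y) isT; rewrite /= nth_index.
Qed.

Lemma ler_mem_sum (R : numDomainType) (T : eqType) (f : T -> R) (s : seq T) (x : T) :
  (forall y, 0 <= f y) -> x \in s -> f x <= \sum_(y <- s) f y.
Proof. by move=> f_ge0 xs; rewrite (big_rem x xs) /= lerDl sumr_ge0. Qed.

Lemma exists_notin (R : numDomainType) (s : seq R) : exists t, t \notin s.
Proof.
pose c := \sum_(x <- s) `|x|; have c_ge0 : 0 <= c by rewrite sumr_ge0.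
exists (1 + c); apply/negP => /(ler_mem_sum (@normr_ge0 _ _)).
by rewrite ger0_norm ?addr_ge0 // -/c gerDr ler10.
Qed.

Lemma sum_antidiagonals (W : nmodType) (F : nat -> nat -> W) (m : nat) :
  \sum_(k < m) \sum_(i < k.+1) F i (k - i)%N = \sum_(i < m) \sum_(j < m - i) F i j.
Proof.
under eq_bigr => k _ do rewrite (big_ord_widen m (fun i => F i (k - i)%N)) //.
rewrite (exchange_big_dep xpredT) //=; apply: eq_bigr => i _.
rewrite -(big_geq_mkord i m xpredT (fun k => F i (k - i)%N)).
rewrite -[X in \sum_(X <= _ < _ | _) _]add0n big_addn big_mkord.
by apply: eq_bigr => j _; rewrite addnK.
Qed.

Lemma mulmx_solvable (F : fieldType) (m n p : nat) (A : 'M[F]_(m, n)) (B : 'M_(m, p)) :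
  (forall d : 'rV_m, d *m A = 0 -> d *m B = 0) -> exists X, A *m X = B.
Proof.
move=> kerAB; have /submxP[X BX] : (B^T <= A^T)%MS; last first.
  by exists X^T; rewrite -[A]trmxK -trmx_mul -BX trmxK.
have KB : (cokermx A^T)^T *m B = 0.
  apply/row_matrixP => i; rewrite row_mul row0; apply: kerAB.
  by rewrite -row_mul -[_^T *m A]trmxK trmx_mul trmxK mulmx_coker trmx0 row0.
by rewrite submxE -[B^T *m _]trmxK trmx_mul trmxK KB trmx0.
Qed.

Lemma odd_mulmx_solvable (m n : nat) (C : 'M[int]_(m, n)) :
  (forall d : 'rV_m, (forall j, (2 %| (d *m C) ord0 j)%Z) -> (2 %| \sum_i d ord0 i)%Z) ->
  exists f : 'cV_n, forall i, ~~ (2 %| (C *m f) i ord0)%Z.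
Proof.
move=> even_ker; have char2 : (2 \in [pchar 'F_2])%N by apply: pchar_Fp.
pose red m' n' (A : 'M[int]_(m', n')) : 'M['F_2]_(m', n') := map_mx intr A.
pose lift m' n' (A : 'M['F_2]_(m', n')) := map_mx (fun x : 'F_2 => (x : nat)%:Z) A.
have liftK m' n' (A : 'M_(m', n')) : red _ _ (lift _ _ A) = A.
  by apply/matrixP => i j; rewrite !mxE -[RHS]natr_Zp.
have [d dC|X CX] := @mulmx_solvable _ _ _ _ (red _ _ C) (const_mx 1 : 'cV_m).
  have /even_ker : forall j, (2 %| (lift _ _ d *m C) ord0 j)%Z.
    move=> j; rewrite (dvdz_pcharf char2).
    by have /rowP/(_ j) := dC; rewrite -{1}(liftK _ _ d) -map_mxM !mxE => ->.
  rewrite (dvdz_pcharf char2) rmorph_sum /= => /eqP d_even.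
  apply/rowP => j; rewrite !mxE -[RHS]d_even; apply: eq_bigr => i _.
  by rewrite -{1}(liftK _ _ d) !mxE mulr1.
exists (lift _ _ X) => i; rewrite (dvdz_pcharf char2).
have /colP/(_ i) := CX.
by rewrite -{1}(liftK _ _ X) -map_mxM !mxE => ->.
Qed.

Lemma odd_system_solvable (T : eqType) (s r : seq T) (C : T -> T -> int) :
  uniq s -> uniq r ->
  (forall d : T -> int, {in r, forall b, 2 %| \sum_(a <- s) d a * C a b}%Z ->
     (2 %| \sum_(a <- s) d a)%Z) ->
  exists f : T -> int, {in s, forall a, ~~ (2 %| \sum_(b <- r) C a b * f b)%Z}.
Proof.
case: s => [|x0 s']; first by exists (fun=> 0).
set s := x0 :: s' => s_uniq r_uniq even_ker.
have sumE (t : seq T) (F : T -> int) : \sum_(a <- t) F a = \sum_(i < size t) F (nth x0 t i).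
  by rewrite (big_nth x0) big_mkord.
have extend (t : seq T) (v : 'I_(size t) -> int) : uniq t ->
    exists f : T -> int, forall i : 'I_(size t), f (nth x0 t i) = v i.
  move=> t_uniq; exists (fun a => oapp v 0 (insub (index a t))) => i.
  by rewrite index_uniq // valK.
pose M := \matrix_(i < size s, j < size r) C (nth x0 s i) (nth x0 r j).
have [d dM|f fM] := @odd_mulmx_solvable _ _ M.
  have [d' d'E] := extend s (d 0) s_uniq.
  under eq_bigr => i _ do rewrite -d'E.
  rewrite -(sumE s d'); apply: even_ker => b; rewrite -index_mem => lt_b.
  have := dM (Ordinal lt_b); rewrite !mxE sumE; congr (_ %| _)%Z; apply: eq_bigr => i _.
  by rewrite !mxE d'E /= nth_index -?index_mem.
have [f' f'E] := extend r (f^~ 0) r_uniq; exists f' => a; rewrite -index_mem => lt_a.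
have := fM (Ordinal lt_a); rewrite !mxE sumE; congr (~~ (_ %| _)%Z); apply: eq_bigr => j _.
by rewrite !mxE f'E /= nth_index -?index_mem.
Qed.

Lemma gram_unitmx (F : realFieldType) (U : vectType F) (B : {biscalar U})
    (n : nat) (X : n.-tuple U) :
  {in <<X>>%VS, forall x, x != 0 -> 0 < B x x} -> free X ->
  \matrix_(i < n, j < n) B X`_i X`_j \in unitmx.
Proof.
move=> B_pos /freeP freeX; rewrite unitmxE unitfE; apply/det0P => -[v v0 vG].
pose x := \sum_i v 0 i *: X`_i.
have Bx (j : 'I_n) : B x X`_j = 0.
  have := congr1 (fun M : 'rV_n => M 0 j) vG; rewrite !mxE => <-.
  by rewrite linear_sumlz; apply: eq_bigr => i _; rewrite linearZl mxE.
have xX : x \in <<X>>%VS.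
  by rewrite rpred_sum // => i _; rewrite rpredZ // memv_span ?mem_nth ?size_tuple.
have x0 : x = 0.
  apply: contraTeq isT => /(B_pos _ xX).
  by rewrite {2}/x linear_sumr big1 ?ltxx // => i _; rewrite linearZr_LR Bx /= mulr0.
by case/eqP: v0; apply/rowP => i; rewrite mxE (freeX (v 0)).
Qed.

Lemma basis_of_spanning (F : fieldType) (U : vectType F) (P : U -> Prop) :
  (forall W : {vspace U}, (forall x, P x -> x \in W) -> W = fullv) ->
  exists2 e : (\dim {:U}).-tuple U, basis_of {:U} e & {in e, forall x, P x}.
Proof.
move=> P_span.
suff [s [s_free sP s_full]] : exists s : seq U,
    [/\ free s, {in s, forall x, P x} & <<s>>%VS = fullv].
  have s_size : size s == \dim {:U} by rewrite -s_full eq_sym.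
  by exists (Tuple s_size) => //; rewrite basisEfree s_free s_full subvf (eqP s_size) leqnn.
suff grow k (s : seq U) : (\dim {:U} - size s <= k)%N -> free s -> {in s, forall x, P x} ->
    exists s' : seq U, [/\ free s', {in s', forall x, P x} & <<s'>>%VS = fullv].
  by apply: (grow (\dim {:U}) [::]); rewrite ?nil_free // leq_subr.
elim: k s => [|k IHk] s size_s s_free sP.
  exists s; split=> //; apply/eqP; rewrite eqEdim subvf /=.
  by move: size_s; rewrite leqn0 subn_eq0 => /leq_trans; apply; rewrite (eqP s_free).
have [s_full|s_nfull] := eqVneq <<s>>%VS fullv; first by exists s.
have [x Px x_notin] : exists2 x, P x & x \notin <<s>>%VS.
  apply: contrapT => no_x; case/eqP: s_nfull; apply: P_span => x Px.
  by apply: contrapT => /negP x_notin; apply: no_x; exists x.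
apply: (IHk (x :: s)) => [||y]; first by rewrite /= subnS; lia.
  by rewrite free_cons x_notin.
by rewrite in_cons => /predU1P[->|/sP].
Qed.

Lemma coord_inj (F : fieldType) (U : vectType F) (n : nat) (e : n.-tuple U) (x y : U) :
  basis_of {:U} e -> (forall i, coord e i x = coord e i y) -> x = y.
Proof.
move=> e_basis xy; rewrite (coord_basis e_basis (memvf x)) (coord_basis e_basis (memvf y)).
by apply: eq_bigr => i _; rewrite xy.
Qed.

Lemma mxtrace_mxof_basis (F : fieldType) (U : vectType F) (e e' : (\dim {:U}).-tuple U)
    (f : 'End(U)) :
  basis_of {:U} e -> basis_of {:U} e' ->
  \tr (passmx.mxof e e f) = \tr (passmx.mxof e' e' f).
Proof.
move=> e_basis e'_basis.
have -> : passmx.mxof e e f = passmx.mxof e e' \1%VF *m passmx.mxof e' e f.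
  by rewrite -(passmx.mxof_comp _ _ e'_basis) comp_lfun1r.
by rewrite mxtrace_mulC -(passmx.mxof_comp _ _ e_basis) comp_lfun1l.
Qed.

Lemma involutive_invlf (F : fieldType) (U : vectType F) (f : 'End(U)) :
  involutive f -> (f^-1)%VF = f.
Proof.
move=> fK; apply/lfunP => x; rewrite -{1}(fK x) lker0_lfunK //.
exact/lker0P/(can_inj fK).
Qed.

Lemma intr_eq_nat (R : numDomainType) (z : int) (n : nat) : z%:~R = n%:R :> R -> z = n.
Proof. by rewrite pmulrn => /intr_inj. Qed.

Section Parity.
Variable R : archiRealFieldType.
Implicit Types x y : R.

Definition evenr x := x / 2 \is a Num.int.
Definition oddr x := evenr (x + 1).

Lemma evenrP x : reflect (exists z : int, x = (2 * z)%:~R) (evenr x).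
Proof.
rewrite /evenr; apply: (iffP intrP) => -[z e]; exists z.
  by rewrite rmorphM /= -e; field.
by rewrite e rmorphM /=; field.
Qed.

Lemma oddrP x : reflect (exists z : int, x = (2 * z + 1)%:~R) (oddr x).
Proof.
apply: (iffP (evenrP _)) => -[z e]; [exists (z - 1)|exists (z + 1)].
  by rewrite -[x](addrK 1) e (_ : 2 * (z - 1) + 1 = 2 * z - 1) ?rmorphB //; lia.
by rewrite e (_ : 2 * (z + 1) = 2 * z + 1 + 1) ?rmorphD //; lia.
Qed.

Lemma evenr_int (z : int) : evenr (z%:~R : R) = (2 %| z)%Z.
Proof.
apply/evenrP/dvdzP => -[q]; first by move=> /intr_inj->; exists q; rewrite mulrC.
by move=> ->; exists q; rewrite mulrC.
Qed.

Lemma oddr_int (z : int) : oddr (z%:~R : R) = ~~ (2 %| z)%Z.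
Proof. by rewrite /oddr -(intrD R z 1) evenr_int; lia. Qed.

Lemma evenr_mulz (z : int) x : evenr x -> evenr (z%:~R * x).
Proof. by rewrite /evenr -mulrA => even_x; rewrite rpredM // intr_int. Qed.

Lemma evenrB x y : evenr x -> evenr y -> evenr (x - y).
Proof. by rewrite /evenr mulrBl; apply: rpredB. Qed.

Lemma evenr_sum (I : eqType) (s : seq I) (F : I -> R) :
  {in s, forall i, evenr (F i)} -> evenr (\sum_(i <- s) F i).
Proof. by move=> evF; rewrite /evenr mulr_suml big_seq rpred_sum. Qed.

End Parity.

(* i^m = re_ipow m + i im_ipow m and (-1)^m = sign_pow m for an integer m *)
Section IntegerPowers.
Variable R : numFieldType.

Definition re_ipow (m : int) : R := [:: 1; 0; -1; 0]`_`|(m %% 4)%Z|.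
Definition im_ipow (m : int) : R := [:: 0; 1; 0; -1]`_`|(m %% 4)%Z|.
Definition sign_pow (m : int) : R := [:: 1; -1; 1; -1]`_`|(m %% 4)%Z|.

Lemma mod4_cases (m : int) :
  [\/ (m %% 4)%Z = 0, (m %% 4)%Z = 1, (m %% 4)%Z = 2 | (m %% 4)%Z = 3].
Proof.
have : (m %% 4)%Z = 0 \/ (m %% 4)%Z = 1 \/ (m %% 4)%Z = 2 \/ (m %% 4)%Z = 3 by lia.
by case=> [|[|[|]]] m4; [apply: Or41|apply: Or42|apply: Or43|apply: Or44].
Qed.

Lemma re_ipow_sqr m : re_ipow m * re_ipow m = 2^-1 * (1 + sign_pow m).
Proof. by rewrite /re_ipow /sign_pow; have [->|->|->|->] := mod4_cases m => /=; field. Qed.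

Lemma im_ipow_sqr m : im_ipow m * im_ipow m = 2^-1 * (1 - sign_pow m).
Proof. by rewrite /im_ipow /sign_pow; have [->|->|->|->] := mod4_cases m => /=; field. Qed.

Lemma sign_mul_re_ipow m : sign_pow m * re_ipow m = re_ipow m.
Proof. by rewrite /re_ipow /sign_pow; have [->|->|->|->] := mod4_cases m => /=; ring. Qed.

Lemma sign_mul_im_ipow m : sign_pow m * im_ipow m = - im_ipow m.
Proof. by rewrite /im_ipow /sign_pow; have [->|->|->|->] := mod4_cases m => /=; ring. Qed.

Lemma re_mul_im_ipow m : re_ipow m * im_ipow m = 0.
Proof. by rewrite /re_ipow /im_ipow; have [->|->|->|->] := mod4_cases m => /=; ring. Qed.

Lemma re_ipowD m k : re_ipow (m + k) = re_ipow m * re_ipow k - im_ipow m * im_ipow k.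
Proof.
rewrite /re_ipow /im_ipow -modzDm.
by have [->|->|->|->] := mod4_cases m; have [->|->|->|->] := mod4_cases k => /=; ring.
Qed.

Lemma im_ipowD m k : im_ipow (m + k) = re_ipow m * im_ipow k + im_ipow m * re_ipow k.
Proof.
rewrite /re_ipow /im_ipow -modzDm.
by have [->|->|->|->] := mod4_cases m; have [->|->|->|->] := mod4_cases k => /=; ring.
Qed.

Lemma sign_powD m k : sign_pow (m + k) = sign_pow m * sign_pow k.
Proof.
rewrite /sign_pow -modzDm.
by have [->|->|->|->] := mod4_cases m; have [->|->|->|->] := mod4_cases k => /=; ring.
Qed.

Lemma sign_pow_sqr m : sign_pow m * sign_pow m = 1.
Proof. by rewrite /sign_pow; have [->|->|->|->] := mod4_cases m => /=; ring. Qed.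

Lemma sign_powN m : sign_pow (- m) = sign_pow m.
Proof.
rewrite /sign_pow; have [m4|m4|m4|m4] := mod4_cases m; rewrite m4.
- by rewrite (_ : (- m %% 4)%Z = 0) //; lia.
- by rewrite (_ : (- m %% 4)%Z = 3) //; lia.
- by rewrite (_ : (- m %% 4)%Z = 2) //; lia.
- by rewrite (_ : (- m %% 4)%Z = 1) //; lia.
Qed.

Lemma sign_pow_odd m : ~~ (2 %| m)%Z -> sign_pow m = -1.
Proof.
rewrite /sign_pow; have [m4|m4|m4|m4] := mod4_cases m; rewrite m4 //; lia.
Qed.

End IntegerPowers.

Arguments re_ipow {R}.
Arguments im_ipow {R}.
Arguments sign_pow {R}.

(** * Root systems *)

Section RootSystem.
Variables (R : archiRealFieldType) (V : vectType R) (form : {dot V for idfun}).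
Local Notation "''[' u , v ]" := (form u%R v%R) : ring_scope.
Local Notation "''[' u ]" := '[u, u] : ring_scope.
Implicit Types (x y : V) (w : seq V).

Lemma dotC x y : '[x, y] = '[y, x].
Proof. by rewrite hermC expr0 mul1r. Qed.

Lemma dot_ge0 x : 0 <= '[x].
Proof. by have [->|/neq0_dnorm_gt0/ltW] := eqVneq x 0; rewrite ?linear0l. Qed.

Lemma dot_eq0 x : ('[x] == 0) = (x == 0).
Proof.
by have [->|/neq0_dnorm_gt0/gt_eqF] := eqVneq x 0; rewrite ?linear0l ?eqxx.
Qed.

Lemma dot_gt0 x : (0 < '[x]) = (x != 0).
Proof. by rewrite lt_def dot_eq0 dot_ge0 andbT. Qed.

Lemma obtuse_relation_le0 (s : seq V) u (k : 'I_(size s) -> R) :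
  uniq s -> {in s, forall a, 0 < '[a, u]} -> {in s &, forall a b, a != b -> '[a, b] <= 0} ->
  \sum_i k i *: s`_i = 0 -> forall i, k i <= 0.
Proof.
move=> s_uniq s_pos s_obtuse k_rel.
have s_in (i : 'I_(size s)) : s`_i \in s by rewrite mem_nth.
pose P := \sum_(i | 0 < k i) k i *: s`_i; pose N := \sum_(i | ~~ (0 < k i)) k i *: s`_i.
have /eqP PN : P == - N.
  by rewrite -addr_eq0 -[X in _ == X]k_rel [X in _ == X](bigID (fun i => 0 < k i)).
(* '[P] = - '[P, N], while obtuseness gives '[P, N] >= 0. *)
have P0 : P = 0.
  apply/eqP; rewrite -dot_eq0 eq_le dot_ge0 andbT {2}PN linearNr oppr_le0.
  rewrite linear_sumlz sumr_ge0 // => i ki_gt0; rewrite linear_sumr sumr_ge0 // => j kj_ngt0.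
  have ij_neq : s`_i != s`_j by rewrite nth_uniq //; apply: contraNneq kj_ngt0 => /val_inj<-.
  rewrite linearZl_LR linearZr_LR /= mulr_ge0 ?(ltW ki_gt0) // mulr_le0 ?s_obtuse //.
  by rewrite leNgt.
move=> i; rewrite leNgt; apply/negP => ki_gt0.
have /eqP : '[P, u] = 0 by rewrite P0 linear0l.
rewrite linear_sumlz psumr_eq0 => [/allP/(_ i (mem_index_enum i))|j kj_gt0].
  by rewrite ki_gt0 linearZl_LR /= mulf_eq0 !gt_eqF // s_pos.
by rewrite linearZl_LR mulr_ge0 // ltW // s_pos.
Qed.

Lemma free_obtuse (s : seq V) u :
  uniq s -> {in s, forall a, 0 < '[a, u]} -> {in s &, forall a b, a != b -> '[a, b] <= 0} ->
  free s.
Proof.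
move=> s_uniq s_pos s_obtuse; rewrite -[s]in_tupleE; apply/freeP => k k_rel i; apply/eqP.
rewrite eq_le (obtuse_relation_le0 s_uniq s_pos s_obtuse k_rel) /= -oppr_le0.
apply: (obtuse_relation_le0 (k := fun i => - k i) s_uniq s_pos s_obtuse).
have := congr1 -%R k_rel; rewrite oppr0 -sumrN => Nk_rel; rewrite -[RHS]Nk_rel.
by apply: eq_bigr => j _; rewrite scaleNr.
Qed.

Definition coroot a x : R := 2 * '[x, a] / '[a].

Fact coroot_linear a : scalar (coroot a).
Proof. by move=> c x y; rewrite /coroot linearPl mulrDr mulrDl mulrCA -!mulrA. Qed.
HB.instance Definition _ a := GRing.isLinear.Build R V R *%R (coroot a) (coroot_linear a).

Definition reflection a x : V := x - coroot a x *: a.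

Fact reflection_linear a : linear (reflection a).
Proof.
by move=> c x y; rewrite /reflection linearP scalerDl -scalerA opprD addrACA -scalerBr.
Qed.
HB.instance Definition _ a :=
  GRing.isLinear.Build R V V *:%R (reflection a) (reflection_linear a).

Lemma corootNl a x : coroot (- a) x = - coroot a x.
Proof. by rewrite /coroot hnormN linearNr mulrN mulNr. Qed.

Lemma coroot_id a : a != 0 -> coroot a a = 2.
Proof. by move=> a0; rewrite /coroot mulfK ?dot_eq0. Qed.

Lemma coroot_eq0 a x : a != 0 -> (coroot a x == 0) = ('[x, a] == 0).
Proof. by move=> a0; rewrite /coroot !mulf_eq0 invr_eq0 dot_eq0 (negPf a0) pnatr_eq0 orbF. Qed.

Lemma coroot_orth a x : '[x, a] = 0 -> coroot a x = 0.
Proof. by move=> xa0; rewrite /coroot xa0 mulr0 mul0r. Qed.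

Lemma coroot_gt0 a x : a != 0 -> (0 < coroot a x) = (0 < '[x, a]).
Proof.
by rewrite -dot_gt0 => a_gt0; rewrite /coroot pmulr_lgt0 ?invr_gt0 // pmulr_rgt0.
Qed.

Lemma dot_orth_component a b : a != 0 -> b != 0 ->
  '[a - (coroot b a / 2) *: b] = (1 - coroot b a * coroot a b / 4) * '[a].
Proof.
move=> a0 b0; rewrite !(linearBl, linearBr, linearZl_LR, linearZr_LR) /= /coroot (dotC b a).
by field; rewrite !dot_eq0 a0.
Qed.

Lemma coroot_mul_le4 a b : a != 0 -> b != 0 -> coroot b a * coroot a b <= 4.
Proof.
move=> a0 b0; have := dot_ge0 (a - (coroot b a / 2) *: b).
by rewrite dot_orth_component // pmulr_lge0 ?dot_gt0 //; lra.
Qed.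

Lemma coroot_mul_eq4 a b : a != 0 -> b != 0 -> coroot b a * coroot a b = 4 ->
  a = (coroot b a / 2) *: b.
Proof.
move=> a0 b0 ab4; apply/eqP; rewrite -subr_eq0 -dot_eq0 dot_orth_component //.
by rewrite ab4 divff ?subrr ?mul0r // pnatr_eq0.
Qed.

Lemma reflectionN a x : reflection (- a) x = reflection a x.
Proof. by rewrite /reflection corootNl scaleNr scalerN opprK. Qed.

Lemma reflection_id a : a != 0 -> reflection a a = - a.
Proof.
by move=> a0; rewrite /reflection coroot_id // scaler_nat mulr2n opprD addrA subrr add0r.
Qed.

Lemma reflection_orth a x : '[x, a] = 0 -> reflection a x = x.
Proof. by move=> /coroot_orth xa0; rewrite /reflection xa0 scale0r subr0. Qed.

Lemma dot_reflection a x y : a != 0 -> '[reflection a x, reflection a y] = '[x, y].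
Proof.
move=> a0; rewrite !(linearBl, linearBr, linearZl_LR, linearZr_LR) /= /coroot (dotC a y).
by field; rewrite dot_eq0.
Qed.

Lemma reflectionK a : a != 0 -> involutive (reflection a).
Proof.
by move=> a0 x; rewrite {2}/reflection linearB linearZ /= reflection_id // scalerN opprK subrK.
Qed.

Lemma reflection_conj a b x : a != 0 ->
  reflection a (reflection b x) = reflection (reflection a b) (reflection a x).
Proof.
by move=> a0; rewrite {2}/reflection linearB linearZ /= [RHS]/reflection /coroot !dot_reflection.
Qed.

Definition reflections w x : V := foldr reflection x w.
Arguments reflections : simpl never.

Fact reflections_linear w : linear (reflections w).
Proof. by rewrite /reflections => c x y; elim: w => //= a w ->; rewrite linearP. Qed.
HB.instance Definition _ w :=
  GRing.isLinear.Build R V V *:%R (reflections w) (reflections_linear w).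

Lemma reflections_cons a w x : reflections (a :: w) x = reflection a (reflections w x).
Proof. by []. Qed.

Lemma reflections_cat w1 w2 x : reflections (w1 ++ w2) x = reflections w1 (reflections w2 x).
Proof. exact: foldr_cat. Qed.

Lemma reflections_rcons w a x : reflections (rcons w a) x = reflections w (reflection a x).
Proof. exact: foldr_rcons. Qed.

Definition root_system (Phi : seq V) : Prop :=
  [/\ 0 \notin Phi, {in Phi &, forall a b, reflection a b \in Phi},
      {in Phi &, forall a b, coroot a b \is a Num.int} &
      {in Phi, forall a, 2 *: a \notin Phi}].

Variable Phi : seq V.
Hypothesis PhiP : root_system Phi.

Lemma root_system_neq0 a : a \in Phi -> a != 0.
Proof. by have [Phi0 _ _ _] := PhiP; apply: contraTneq => ->. Qed.

Lemma root_reflection a b : a \in Phi -> b \in Phi -> reflection a b \in Phi.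
Proof. by have [_ refl _ _] := PhiP; apply: refl. Qed.

Lemma coroot_int a b : a \in Phi -> b \in Phi -> coroot a b \is a Num.int.
Proof. by have [_ _ int _] := PhiP; apply: int. Qed.

Lemma double_notin_roots a : a \in Phi -> 2 *: a \notin Phi.
Proof. by have [_ _ _ red] := PhiP; apply: red. Qed.

Lemma root_opp a : (- a \in Phi) = (a \in Phi).
Proof.
suff opp b : b \in Phi -> - b \in Phi by apply/idP/idP => /opp; rewrite ?opprK.
by move=> bPhi; rewrite -reflection_id ?root_system_neq0 ?root_reflection.
Qed.

Lemma coroot_cases a b : a \in Phi -> b \in Phi -> a != b -> 0 < '[a, b] ->
  coroot b a = 1 \/ coroot a b = 1 /\ (coroot b a = 2 \/ coroot b a = 3).
Proof.
move=> aPhi bPhi ab_neq ab_gt0; have [a0 b0] := (root_system_neq0 aPhi, root_system_neq0 bPhi).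
have /intrP[p pE] := coroot_int bPhi aPhi; have /intrP[q qE] := coroot_int aPhi bPhi.
have p_gt0 : 0 < p by rewrite -(ltr0z R) -pE coroot_gt0.
have q_gt0 : 0 < q by rewrite -(ltr0z R) -qE coroot_gt0 // dotC.
have pq_le4 : p * q <= 4 by rewrite -(ler_int R) intrM -pE -qE coroot_mul_le4.
have pq_eq4 : p * q = 4 -> a = (p%:~R / 2) *: b.
  by move=> pq4; rewrite -pE; apply: coroot_mul_eq4 => //; rewrite pE qE -intrM pq4.
have p2_q2 : ~ (p = 2 /\ q = 2).
  by move=> [p2 q2]; case/eqP: ab_neq; rewrite pq_eq4 p2 ?q2 // divff ?scale1r // pnatr_eq0.
have p4_q1 : ~ (p = 4 /\ q = 1).
  move=> [p4 q1]; have := double_notin_roots bPhi; suff <- : a = 2 *: b by rewrite aPhi.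
  by rewrite pq_eq4 p4 ?q1 //; congr (_ *: _); lra.
have: p = 1 \/ q = 1 /\ (p = 2 \/ p = 3).
  have: p = 1 \/ p = 2 \/ p = 3 \/ p = 4 by nia.
  by move=> [|[|[|]]] p_eq; rewrite p_eq in pq_le4 p2_q2 p4_q1 *; lia.
rewrite pE qE => -[->|[-> [->|->]]]; [by left|right..]; split=> //; by [left|right].
Qed.

Lemma root_sub a b : a \in Phi -> b \in Phi -> a != b -> 0 < '[a, b] -> a - b \in Phi.
Proof.
move=> aPhi bPhi ab_neq ab_gt0.
have [ba1|[ab1 _]] := coroot_cases aPhi bPhi ab_neq ab_gt0.
  by have := root_reflection bPhi aPhi; rewrite /reflection ba1 scale1r.
by have := root_reflection aPhi bPhi; rewrite /reflection ab1 scale1r -opprB root_opp.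
Qed.

Lemma dot_reflections w x y : {subset w <= Phi} ->
  '[reflections w x, reflections w y] = '[x, y].
Proof.
elim: w => // a w IHw /allP/=/andP[aPhi /allP wPhi].
by rewrite !reflections_cons dot_reflection ?IHw ?root_system_neq0.
Qed.

Lemma root_reflections w a : {subset w <= Phi} -> a \in Phi -> reflections w a \in Phi.
Proof.
move=> wPhi aPhi; elim: w wPhi => // b w IHw /allP/=/andP[bPhi /allP wPhi].
by rewrite reflections_cons root_reflection ?IHw.
Qed.

Lemma reflections_conj w a x : {subset w <= Phi} ->
  reflections w (reflection a x) = reflection (reflections w a) (reflections w x).
Proof. by move=> wPhi; rewrite /reflection linearB linearZ /= /coroot !dot_reflections. Qed.

(** * Simple roots *)

Definition regular u := {in Phi, forall a, '[a, u] != 0}.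

Section SimpleRoots.
Variable u : V.
Hypothesis u_regular : regular u.

Definition positive a := (a \in Phi) && (0 < '[a, u]).

Definition simple a := positive a && ~~ has (fun b => positive b && positive (a - b)) Phi.

Definition simple_roots := [seq a <- undup Phi | simple a].

Lemma positive_root a : positive a -> a \in Phi.
Proof. by case/andP. Qed.

Lemma positive_gt0 a : positive a -> 0 < '[a, u].
Proof. by case/andP. Qed.

Lemma positive_opp a : a \in Phi -> positive (- a) = ~~ positive a.
Proof.
by move=> aPhi; rewrite /positive root_opp aPhi linearNl oppr_gt0 -leNgt lt_neqAle u_regular.
Qed.

Lemma simple_positive a : simple a -> positive a.
Proof. by case/andP. Qed.

Lemma simple_root a : simple a -> a \in Phi.
Proof. by move/simple_positive/positive_root. Qed.

Lemma all_simple_root w : all simple w -> {subset w <= Phi}.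
Proof. by move=> /allP w_simple a /w_simple/simple_root. Qed.

Lemma mem_simple_roots a : (a \in simple_roots) = simple a.
Proof. by rewrite mem_filter mem_undup andb_idr // => /simple_root. Qed.

Lemma simple_roots_uniq : uniq simple_roots.
Proof. exact/filter_uniq/undup_uniq. Qed.

Lemma simple_neq_add a b c : simple a -> positive b -> positive c -> a != b + c.
Proof.
move=> /andP[_ /hasPn a_indec] bpos cpos; apply/eqP => a_bc.
by have := a_indec b (positive_root bpos); rewrite a_bc addrC addKr bpos cpos.
Qed.

Lemma positive_sub_simple a b : simple a -> positive b -> b - a \in Phi -> positive (b - a).
Proof.
move=> asim bpos baPhi; apply: contraT; rewrite -positive_opp // opprB => abpos.
by have := simple_neq_add asim bpos abpos; rewrite addrC subrK eqxx.
Qed.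

Lemma reflection_simple_positive a b :
  simple a -> positive b -> b != a -> positive (reflection a b).
Proof.
move=> asim bpos ba_neq; have [aPhi bPhi] := (simple_root asim, positive_root bpos).
have a0 := root_system_neq0 aPhi; have rPhi := root_reflection aPhi bPhi.
have [ba_gt0|ba_le0] := ltrP 0 '[b, a]; last first.
  rewrite /positive rPhi linearBl linearZl_LR /= subr_gt0 (le_lt_trans _ (positive_gt0 bpos)) //.
  by rewrite pmulr_lle0 ?positive_gt0 ?simple_positive // leNgt coroot_gt0 // -leNgt.
have bapos : positive (b - a) by rewrite positive_sub_simple ?root_sub.
have [ab1|[_ [ab2|ab3]]] := coroot_cases bPhi aPhi ba_neq ba_gt0.
- by rewrite /reflection ab1 scale1r.
- have r_eq : reflection a b = b - a - a by rewrite /reflection ab2 scaler_nat mulr2n opprD addrA.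
  by rewrite r_eq positive_sub_simple // -r_eq.
have r_eq : reflection a b = b - a - a - a.
  by rewrite /reflection ab3 scaler_nat !mulrS mulr0n addr0 !opprD !addrA.
have r'_eq : reflection a (b - a) = b - a - a.
  by rewrite linearB /= reflection_id // r_eq opprK subrK.
rewrite r_eq; apply: positive_sub_simple; rewrite -?r_eq //.
by apply: positive_sub_simple; rewrite -?r'_eq ?root_reflection // positive_root.
Qed.

Lemma positive_ind (P : V -> Prop) :
  (forall b, positive b -> (forall c, positive c -> '[c, u] < '[b, u] -> P c) -> P b) ->
  forall b, positive b -> P b.
Proof.
move=> step b bpos; suff : {in Phi, forall c, positive c -> P c}.
  by apply; first exact: positive_root.
apply: (seq_lt_ind (f := fun c => '[c, u])) => c _ IHc cpos; apply: step => // d dpos dc.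
exact: IHc (positive_root dpos) dc dpos.
Qed.

Lemma positive_simple_sum b : positive b ->
  exists c : V -> nat, b = \sum_(a <- simple_roots) (c a)%:R *: a.
Proof.
elim/positive_ind => {}b bpos IHb; have [bsim|] := boolP (simple b).
  exists (fun a => (a == b) : nat).
  rewrite (bigD1_seq b) ?mem_simple_roots ?simple_roots_uniq //= eqxx scale1r big1 ?addr0 //.
  by move=> a /negPf->; rewrite scale0r.
rewrite /simple bpos negbK => /hasP[c _ /andP[cpos bcpos]].
have [c_gt0] := (positive_gt0 cpos, positive_gt0 bcpos); rewrite linearBl => bc_gt0.
have [//||f cE] := IHb c; first by lra.
have [//||g bcE] := IHb (b - c); first by rewrite linearBl; lra.
exists (fun a => g a + f a)%N; rewrite -[LHS](subrK c) {1}bcE {1}cE -big_split /=.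
by apply: eq_bigr => a _; rewrite natrD scalerDl.
Qed.

Lemma simple_obtuse a b : simple a -> simple b -> a != b -> '[a, b] <= 0.
Proof.
move=> asim bsim ab_neq; rewrite leNgt; apply/negP => ab_gt0.
have abPhi := root_sub (simple_root asim) (simple_root bsim) ab_neq ab_gt0.
have abpos := positive_sub_simple bsim (simple_positive asim) abPhi.
by have := simple_neq_add asim abpos (simple_positive bsim); rewrite subrK eqxx.
Qed.

Lemma simple_roots_free : free simple_roots.
Proof.
apply: (@free_obtuse _ u) => [|a|a b]; first exact: simple_roots_uniq.
  by rewrite mem_simple_roots => /simple_positive/positive_gt0.
by rewrite !mem_simple_roots; apply: simple_obtuse.
Qed.

Lemma exists_simple_acute b : positive b -> exists2 a, simple a & 0 < '[b, a].
Proof.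
move=> bpos; have [c bE] := positive_simple_sum bpos.
have [/hasP[a]|/hasPn obtuse] := boolP (has (fun a => 0 < '[b, a]) simple_roots).
  by rewrite mem_simple_roots; exists a.
have := root_system_neq0 (positive_root bpos).
rewrite -dot_gt0 {2}bE linear_sumr ltNge => /negP[]; rewrite big_seq sumr_le0 // => a /obtuse.
by rewrite -leNgt linearZr_LR => ba_le0; rewrite mulr_ge0_le0.
Qed.

Lemma reflection_simple_word b : b \in Phi ->
  exists2 w, all simple w & reflection b =1 reflections w.
Proof.
suff wordP c : positive c -> exists2 w, all simple w & reflection c =1 reflections w.
  move=> bPhi; have [/wordP//|] := boolP (positive b).
  rewrite -positive_opp // => /wordP[w w_simple bw].
  by exists w => // x; rewrite -bw reflectionN.
elim/positive_ind => {}c cpos IHc.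
have [csim|c_nsim] := boolP (simple c); first by exists [:: c]; rewrite /= ?csim.
have [a asim ca_gt0] := exists_simple_acute cpos.
have a0 := root_system_neq0 (simple_root asim).
have ca_neq : c != a by apply: contraNneq c_nsim => ->.
have [|w w_simple rw] := IHc (reflection a c) (reflection_simple_positive asim cpos ca_neq).
  rewrite linearBl linearZl_LR /= ltrBlDr ltrDl pmulr_rgt0 ?positive_gt0 ?simple_positive //.
  by rewrite coroot_gt0.
exists (a :: rcons w a) => [|x]; first by rewrite /= all_rcons asim.
by rewrite reflections_cons reflections_rcons -rw -reflection_conj // !reflectionK.
Qed.

Lemma reflections_simple_word w : {subset w <= Phi} ->
  exists2 w', all simple w' & reflections w =1 reflections w'.
Proof.
elim: w => [|a w IHw]; first by exists [::].
move=> /allP/=/andP[/reflection_simple_word[v v_simple av] /allP/IHw[w' w'_simple ww']].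
exists (v ++ w') => [|x]; first by rewrite all_cat v_simple.
by rewrite reflections_cat reflections_cons av ww'.
Qed.

Lemma exchange w a : all simple w -> simple a -> ~~ positive (reflections w a) ->
  exists w', [/\ all simple w', (size w' < size w)%N &
                 forall x, reflections w' x = reflections w (reflection a x)].
Proof.
move=> + asim; elim: w => [|b w IHw] /=; first by rewrite /reflections /= simple_positive.
case/andP => bsim w_simple.
have [wapos|wa_npos _] := boolP (positive (reflections w a)); last first.
  have [w' [w'_simple lt_size w'E]] := IHw w_simple wa_npos.
  by exists (b :: w'); split=> [||x]; rewrite ?ltnS //= ?bsim // !reflections_cons w'E.
have [wa_b _|wa_neq_b] := eqVneq (reflections w a) b; last first.
  by rewrite reflections_cons reflection_simple_positive.
exists w; split=> // x; rewrite reflections_cons reflections_conj ?wa_b ?reflectionK //.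
  exact: root_system_neq0 (simple_root bsim).
exact: all_simple_root.
Qed.

Lemma reflections_positive_id w : {subset w <= Phi} ->
  (forall a, positive a -> positive (reflections w a)) -> reflections w =1 id.
Proof.
move=> /reflections_simple_word[v v_simple wv] w_pos x; rewrite wv.
have {w wv w_pos}: forall a, positive a -> positive (reflections v a).
  by move=> a apos; rewrite -wv w_pos.
have [n] := ubnP (size v); elim: n v v_simple => // n IHn v.
case/lastP: v => // v a; rewrite all_rcons size_rcons ltnS => /andP[asim v_simple] v_lt v_pos.
have [a0 vPhi] := (root_system_neq0 (simple_root asim), all_simple_root v_simple).
have : positive (reflections (rcons v a) a) by apply/v_pos/simple_positive.
rewrite reflections_rcons reflection_id // linearN /=.
rewrite positive_opp ?root_reflections ?simple_root //.
case/(exchange v_simple asim) => v' [v'_simple v'_lt v'E].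
have vE y : reflections (rcons v a) y = reflections v' y by rewrite reflections_rcons v'E.
rewrite vE; apply: IHn => // [|b /v_pos]; first exact: ltn_trans v'_lt v_lt.
by rewrite vE.
Qed.

End SimpleRoots.

(** * Involutions of the Weyl group *)

Lemma avoid_hyperplanes (s : seq V) : 0 \notin s -> exists y, {in s, forall a, '[a, y] != 0}.
Proof.
elim: s => [|a s IHs]; first by exists 0.
rewrite in_cons negb_or eq_sym => /andP[a0 /IHs[y y_s]].
have [t] := exists_notin (- '[a, y] / '[a] :: [seq - '[b, y] / '[b, a] | b <- s]).
rewrite in_cons negb_or => /andP[t_a t_s]; exists (y + t *: a) => b.
have off_root c : '[c, a] != 0 -> t != - '[c, y] / '[c, a] -> '[c, y + t *: a] != 0.
  move=> ca0; apply: contra_neq; rewrite linearDr linearZr_LR /= => /eqP.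
  by rewrite addrC addr_eq0 => /eqP <-; rewrite mulfK.
rewrite in_cons => /predU1P[->|bs]; first by rewrite off_root // dot_eq0.
have [ba0|ba_neq0] := eqVneq '[b, a] 0.
  by rewrite linearDr linearZr_LR /= ba0 mulr0 addr0 y_s.
by rewrite off_root //; apply: contraNneq t_s => ->; apply: (map_f (fun b => - '[b, y] / '[b, a])).
Qed.

Lemma exists_regular : exists u, regular u.
Proof. by apply: avoid_hyperplanes; case: PhiP. Qed.

Lemma exists_adjacent_chamber v :
  exists2 u, regular u & {in Phi, forall a, 0 < '[a, u] -> 0 <= '[a, v]}.
Proof.
have [u0 u0_regular] := exists_regular.
pose ratio a := `|'[a, u0]| / `|'[a, v]|; pose M := 1 + \sum_(a <- Phi) ratio a.
have uE a : '[a, M *: v + u0] = M * '[a, v] + '[a, u0] by rewrite linearDr linearZr_LR.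
have dominates a : a \in Phi -> '[a, v] != 0 -> `|'[a, u0]| < `|M * '[a, v]|.
  move=> aPhi av0; have av_gt0 : 0 < `|'[a, v]| by rewrite normr_gt0.
  have ratio_ge0 b : 0 <= ratio b by rewrite divr_ge0.
  have ratio_lt : ratio a < M.
    by rewrite ltr_pwDl ?ltr01 // (ler_mem_sum ratio_ge0).
  rewrite normrM -ltr_pdivrMr //; apply: lt_le_trans ratio_lt (ler_norm _).
exists (M *: v + u0) => a aPhi; rewrite uE.
  have [->|av0] := eqVneq '[a, v] 0; first by rewrite mulr0 add0r u0_regular.
  rewrite addr_eq0; apply: contraTneq (dominates a aPhi av0) => ->.
  by rewrite normrN ltxx.
move=> u_gt0; rewrite leNgt; apply/negP => av_lt0.
have := dominates a aPhi (ltr0_neq0 av_lt0); have := ler_norm '[a, u0].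
have M_gt0 : 0 < M by rewrite ltr_pwDl ?sumr_ge0 // => b _; rewrite divr_ge0.
by rewrite (ltr0_norm (x := M * _)) ?pmulr_rlt0 //; lra.
Qed.

Section Involution.
Variable w : seq V.
Hypothesis w_roots : {subset w <= Phi}.
Hypothesis w_inv : involutive (reflections w).

Lemma reflections_involution_dot x y : '[reflections w x, y] = '[x, reflections w y].
Proof. by rewrite -[in LHS](w_inv y) dot_reflections. Qed.

Lemma generic_fixed_vector :
  exists2 v, reflections w v = v & {in Phi, forall a, ('[a, v] == 0) = (reflections w a == - a)}.
Proof.
pose fixed_part a := a + reflections w a.
have [|y y_avoids] := @avoid_hyperplanes [seq a <- [seq fixed_part a | a <- Phi] | a != 0].
  by rewrite mem_filter eqxx.
exists (y + reflections w y) => [|a aPhi]; first by rewrite linearD /= w_inv addrC.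
have -> : '[a, y + reflections w y] = '[fixed_part a, y].
  by rewrite linearDr linearDl /= reflections_involution_dot.
rewrite -[RHS]addr_eq0 addrC -/(fixed_part a).
apply/idP/eqP => [|->]; last by rewrite linear0l.
by apply: contraTeq => fa0; rewrite y_avoids // mem_filter fa0 map_f.
Qed.

Lemma involution_no_negated_root :
  {in Phi, forall a, reflections w a != - a} -> reflections w =1 id.
Proof.
move=> no_neg; have [v wv v_generic] := generic_fixed_vector.
have v_regular : regular v by move=> a aPhi; rewrite v_generic // no_neg.
apply: (reflections_positive_id v_regular) => // a /andP[aPhi av_gt0].
by rewrite /positive root_reflections // -wv dot_reflections.
Qed.

End Involution.

Definition strongly_orthogonal (G : seq V) : Prop :=
  [/\ uniq G, {subset G <= Phi} &
      {in G &, forall g g', g != g' -> [/\ '[g, g'] = 0, g + g' \notin Phi & g - g' \notin Phi]}].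

Lemma strongly_orthogonal_cons g G :
  strongly_orthogonal (g :: G) <->
  [/\ g \in Phi, strongly_orthogonal G &
      {in G, forall g', [/\ '[g, g'] = 0, g + g' \notin Phi & g - g' \notin Phi]}].
Proof.
split=> [[/= /andP[gG uG] GPhi so]|[gPhi [uG GPhi so] gso]].
  have inG g' : g' \in G -> g' \in g :: G by rewrite in_cons orbC => ->.
  split=> [||g' g'G]; first by rewrite GPhi ?mem_head.
    split=> // [a /inG/GPhi//|a b /inG aG /inG bG]; exact: so.
  by apply: so; rewrite ?mem_head ?inG //; apply: contraNneq gG => ->.
have gG : g \notin G.
  apply/negP => /gso[/eqP]; rewrite dot_eq0 => /eqP g0.
  by have := root_system_neq0 gPhi; rewrite g0 eqxx.
split=> [|a|a b]; first by rewrite /= gG.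
  by rewrite in_cons => /predU1P[->|/GPhi].
rewrite !in_cons => /predU1P[->|aG] /predU1P[->|bG]; first by rewrite eqxx.
- by move=> _; apply: gso.
- by have [o pl mi] := gso a aG; rewrite dotC addrC -opprB root_opp.
- exact: so.
Qed.

(* Among the roots negated by the involution, a longest one is strongly
   orthogonal to every root orthogonal to it: a sum or difference of the two
   would be negated and longer. *)
Lemma longest_negated_strongly_orthogonal w g a :
  '[g, a] = 0 -> a != 0 -> reflections w g = - g -> reflections w a = - a ->
  {in Phi, forall b, reflections w b = - b -> '[b] <= '[g]} ->
  g + a \notin Phi /\ g - a \notin Phi.
Proof.
move=> ga0 a0 wg wa longest; have a_gt0 : 0 < '[a] by rewrite dot_gt0.
split; apply/negP => /longest; rewrite linearD ?linearN /= wg wa -opprD => /(_ erefl).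
  by rewrite hnormDd // gerDl leNgt a_gt0.
by rewrite hnormBd // gerDl leNgt a_gt0.
Qed.

Section SplitReflection.
Variables (w : seq V) (g : V).
Hypothesis w_roots : {subset w <= Phi}.
Hypothesis w_inv : involutive (reflections w).
Hypothesis gPhi : g \in Phi.
Hypothesis wg : reflections w g = - g.

Lemma rcons_roots : {subset rcons w g <= Phi}.
Proof. by move=> a; rewrite mem_rcons in_cons => /predU1P[->|/w_roots]. Qed.

Lemma reflections_rcons_involutive : involutive (reflections (rcons w g)).
Proof.
move=> x; rewrite !reflections_rcons reflections_conj // wg reflectionN w_inv.
by rewrite reflectionK // root_system_neq0.
Qed.

Lemma reflections_rcons_id : reflections (rcons w g) g = g.
Proof.
by rewrite reflections_rcons reflection_id ?root_system_neq0 // linearN /= wg opprK.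
Qed.

Lemma negated_rcons a :
  (reflections (rcons w g) a == - a) = (reflections w a == - a) && ('[g, a] == 0).
Proof.
apply/eqP/andP => [wga|[/eqP wa /eqP ga]].
  have ga0 : '[g, a] = 0.
    have := dot_reflections g a rcons_roots.
    by rewrite reflections_rcons_id wga linearNr; lra.
  by rewrite -wga reflections_rcons reflection_orth ?ga0 // dotC.
by rewrite reflections_rcons reflection_orth // dotC.
Qed.

End SplitReflection.

Lemma weyl_involution_strongly_orthogonal w :
  {subset w <= Phi} -> involutive (reflections w) ->
  exists G : seq V, [/\ strongly_orthogonal G, {in G, forall g, reflections w g = - g} &
    forall x, reflections w x = x - \sum_(g <- G) coroot g x *: g].
Proof.
pose negated w := [pred a | reflections w a == - a].
have [n] := ubnP (count (negated w) Phi).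
elim: n w => // n IHn w; rewrite ltnS => count_le w_roots w_inv.
have [/hasP[a0 a0Phi wa0]|/hasPn no_neg] := boolP (has (negated w) Phi); last first.
  exists [::]; split=> // x; rewrite big_nil subr0.
  exact: involution_no_negated_root.
have [|g] := @seq_argmax _ _ _ (fun a => '[a]) [seq a <- Phi | negated w a] a0.
  by rewrite mem_filter wa0.
rewrite mem_filter => /andP[/eqP wg gPhi] g_longest.
have longest : {in Phi, forall b, reflections w b = - b -> '[b] <= '[g]}.
  by move=> b bPhi /eqP wb; apply: g_longest; rewrite mem_filter /= wb.
have g0 := root_system_neq0 gPhi.
have [|||G [G_so G_neg wE]] := IHn (rcons w g).
- apply: leq_trans count_le; apply: (@sub_count_ltn _ _ _ _ g) => //=.
  + by move=> a /=; rewrite negated_rcons // => /andP[].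
  + by rewrite wg.
  + by rewrite negated_rcons // dot_eq0 (negPf g0) andbF.
- exact: rcons_roots.
- exact: reflections_rcons_involutive.
have G_orth g' : g' \in G -> '[g, g'] = 0 /\ reflections w g' = - g'.
  by move/G_neg/eqP; rewrite negated_rcons // => /andP[/eqP ? /eqP ?].
exists (g :: G); split=> [|g'|x].
- apply/strongly_orthogonal_cons; split=> // g' g'G.
  have [_ GPhi _] := G_so; have g'0 := root_system_neq0 (GPhi _ g'G).
  have [gg' wg'] := G_orth g' g'G.
  by have [] := longest_negated_strongly_orthogonal gg' g'0 wg wg' longest.
- by rewrite in_cons => /predU1P[->|/G_orth[]].
rewrite -{1}(reflectionK g0 x) -reflections_rcons wE big_cons {1}/reflection opprD addrA.
congr (_ - _); rewrite !big_seq; apply: eq_bigr => g' /G_orth[gg' _].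
by rewrite linearB linearZ /= (coroot_orth gg') mulr0 subr0.
Qed.

(** * Odd coweights *)

Lemma strongly_orthogonal_perm G1 G2 :
  perm_eq G1 G2 -> strongly_orthogonal G1 -> strongly_orthogonal G2.
Proof.
move=> G12 [uG GPhi so]; have memG := perm_mem G12.
by split=> [|a|a b]; rewrite -?(perm_uniq G12) -?memG; auto.
Qed.

Lemma coroot_strongly_orthogonal_sum G (c : V -> R) g : strongly_orthogonal G -> g \in G ->
  coroot g (\sum_(g' <- G) c g' *: g') = 2 * c g.
Proof.
move=> [uG GPhi so] gG; rewrite linear_sum (bigD1_seq g) //= big_seq_cond big1.
  by rewrite addr0 linearZ /= coroot_id 1?mulrC // root_system_neq0 ?GPhi.
move=> g' /andP[g'G g'g]; have [g'g0 _ _] := so _ _ g'G gG g'g.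
by rewrite linearZ /= coroot_orth ?mulr0.
Qed.

Lemma even_coroot_eq2 g e (b : R) : g \in Phi -> e \in Phi -> e != g -> 0 < '[e, g] ->
  b \is a Num.int -> coroot g e = 2 * b -> b = 1.
Proof.
move=> gPhi ePhi e_neq eg_gt0 /intrP[z ->]; rewrite -(intrM R 2) => g_eE.
have : 2 * z = 1 \/ 2 * z = 2 \/ 2 * z = 3.
  have := coroot_cases ePhi gPhi e_neq eg_gt0; rewrite g_eE.
  case=> [/(intr_eq_nat (n := 1))|[_ [/(intr_eq_nat (n := 2))|/(intr_eq_nat (n := 3))]]]; auto.
by move=> z_eq; rewrite (_ : z = 1) //; lia.
Qed.

Lemma int_comb_strongly_orthogonal G (c : V -> R) d : strongly_orthogonal G ->
  {in G, forall g, c g \is a Num.int} -> d \in Phi -> d = \sum_(g <- G) c g *: g ->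
  exists2 g, g \in G & d = g \/ d = - g.
Proof.
elim: G c d => [|g G IHG] c d gGso c_int dPhi dE.
  by have := root_system_neq0 dPhi; rewrite dE big_nil eqxx.
have [gPhi Gso g_so] := (strongly_orthogonal_cons g G).1 gGso.
have inG g' : g' \in G -> g' \in g :: G by rewrite in_cons orbC => ->.
have [c0|c_neq0] := eqVneq (c g) 0.
  move: dE; rewrite big_cons c0 scale0r add0r => dE.
  by have [g' /inG] := IHG c d Gso (fun g' => c_int g' \o @inG g') dPhi dE; exists g'.
(* Otherwise d - g is a root and an integral combination of G, so plus or minus
   some g' in G, and d = g +- g' contradicts strong orthogonality. *)
have pos_case b e : {in g :: G, forall g', b g' \is a Num.int} -> e \in Phi ->
    e = \sum_(g' <- g :: G) b g' *: g' -> 0 < b g -> e = g.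
  move=> b_int ePhi eE b_gt0; apply/eqP; apply: contraT => e_neq.
  have g_e : coroot g e = 2 * b g by rewrite eE coroot_strongly_orthogonal_sum ?mem_head.
  have eg_gt0 : 0 < '[e, g] by rewrite -coroot_gt0 ?root_system_neq0 // g_e mulr_gt0.
  have b1 : b g = 1 := even_coroot_eq2 gPhi ePhi e_neq eg_gt0 (b_int g (mem_head _ _)) g_e.
  have eg_E : e - g = \sum_(g' <- G) b g' *: g' by rewrite eE big_cons b1 scale1r addrC addKr.
  have egPhi := root_sub ePhi gPhi e_neq eg_gt0.
  have [g' g'G] := IHG b _ Gso (fun g' => b_int g' \o @inG g') egPhi eg_E.
  have [_ gg'p gg'm] := g_so g' g'G.
  move=> [] /eqP; rewrite subr_eq addrC => /eqP eq_e.
    by move: gg'p; rewrite -eq_e ePhi.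
  by move: gg'm; rewrite -eq_e ePhi.
exists g; first exact: mem_head.
have [c_gt0|c_lt0|c0] := ltrgt0P (c g); last by rewrite c0 eqxx in c_neq0.
  by left; apply: pos_case dE _.
right; apply: oppr_inj; rewrite opprK.
apply: (pos_case (fun g' => - c g')); rewrite ?root_opp ?oppr_gt0 //.
  by move=> g' /c_int; rewrite rpredN.
by rewrite dE -sumrN; apply: eq_bigr => g' _; rewrite scaleNr.
Qed.

Lemma sqr_int_comb_sum G (c : V -> R) : strongly_orthogonal G ->
  {in G, forall g, c g \is a Num.int} -> \sum_(g <- G) c g *: g \in Phi ->
  (\sum_(g <- G) c g) ^+ 2 = 1.
Proof.
move=> Gso c_int dPhi; have [G_uniq GPhi G_orth] := Gso.
have [g gG d_g] := int_comb_strongly_orthogonal Gso c_int dPhi erefl.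
have [f f2 dE] : exists2 f : R, f ^+ 2 = 1 & \sum_(g <- G) c g *: g = f *: g.
  by case: d_g => ->; [exists 1|exists (-1)]; rewrite ?scale1r ?scaleN1r ?sqrrN ?expr1n.
have coef g' : g' \in G -> 2 * c g' = f * coroot g' g.
  by move=> g'G; rewrite -(coroot_strongly_orthogonal_sum c Gso g'G) dE linearZ.
suff -> : \sum_(g <- G) c g = f by [].
rewrite (bigD1_seq g) //= big_seq_cond big1 ?addr0.
  by have := coef g gG; rewrite coroot_id ?(root_system_neq0 (GPhi _ _)) //; lra.
move=> g' /andP[g'G g'g]; have [g'_orth _ _] := G_orth _ _ g'G gG g'g.
have g_orth : coroot g' g = 0 by apply: coroot_orth; rewrite dotC.
by have := coef g' g'G; rewrite g_orth mulr0; lra.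
Qed.

Lemma coroot_parity_acute a g : a \in Phi -> g \in Phi -> 0 < '[a, g] ->
  evenr (coroot g a * coroot a g - coroot g a) \/ coroot g a = 1 /\ coroot a g = 2.
Proof.
move=> aPhi gPhi ag_gt0; have [<-|ag_neq] := eqVneq a g.
  by left; rewrite coroot_id ?root_system_neq0 //; apply/evenrP; exists 1; ring.
have [ga1|[-> _]] := coroot_cases aPhi gPhi ag_neq ag_gt0; last first.
  by left; apply/evenrP; exists 0; ring.
rewrite eq_sym in ag_neq; rewrite dotC in ag_gt0.
have [ag1|[_ [ag2|ag3]]] := coroot_cases gPhi aPhi ag_neq ag_gt0; rewrite ga1.
- by left; rewrite ag1; apply/evenrP; exists 0; ring.
- by right.
- by left; rewrite ag3; apply/evenrP; exists 1; ring.
Qed.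

Lemma coroot_parity a g : a \in Phi -> g \in Phi ->
  evenr (coroot g a * coroot a g - coroot g a) \/
  coroot g a ^+ 2 = 1 /\ coroot a g = 2 * coroot g a.
Proof.
move=> aPhi gPhi; have [ag_gt0|ag_lt0|ag0] := ltrgt0P '[a, g].
- have [|[-> ->]] := coroot_parity_acute aPhi gPhi ag_gt0; first by left.
  by right; rewrite expr1n mulr1.
- have [||even|[ga1 ag2]] := @coroot_parity_acute a (- g) aPhi _ _;
    rewrite ?root_opp ?linearNr ?oppr_gt0 //.
    left; move: even; rewrite corootNl linearN /= mulrNN => even.
    have -> : coroot g a * coroot a g - coroot g a =
        coroot g a * coroot a g - - coroot g a - 2 * coroot g a by ring.
    apply: evenrB => //; have /intrP[z ->] := coroot_int gPhi aPhi.
    by apply/evenrP; exists z; rewrite rmorphM.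
  right; move: ga1 ag2; rewrite corootNl linearN /= => /eqP; rewrite eqr_oppLR => /eqP-> /eqP.
  by rewrite eqr_oppLR => /eqP->; split; ring.
- have /eqP ga0 : coroot g a == 0 by rewrite coroot_eq0 ?root_system_neq0 ?ag0.
  by left; rewrite ga0; apply/evenrP; exists 0; ring.
Qed.

Section ParityOfCoroots.
Variables (G : seq V) (a : V).
Hypothesis Gso : strongly_orthogonal G.
Hypothesis aPhi : a \in Phi.
Hypothesis aE : 2 *: a = \sum_(g <- G) coroot g a *: g.

Lemma sum_coroot_mul : \sum_(g <- G) coroot g a * coroot a g = 4.
Proof.
have := congr1 (coroot a) aE; rewrite linearZ /= coroot_id ?root_system_neq0 // linear_sum /=.
under eq_bigr => g _ do rewrite linearZ /=.
by move=> <-; ring.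
Qed.

Lemma sum_coroot_exceptional g1 : g1 \in G -> coroot g1 a ^+ 2 = 1 ->
  coroot a g1 = 2 * coroot g1 a -> evenr (\sum_(g <- G) coroot g a).
Proof.
move=> g1G; have sqr_eq1 (x : R) : x ^+ 2 = 1 -> x = 1 \/ x = -1.
  by move=> /eqP; rewrite sqrf_eq1 => /orP[] /eqP; [left|right].
set e := coroot g1 a => e2 ag1; have perm_g1 := perm_to_rem g1G.
pose G1 := rem g1 G.
have /strongly_orthogonal_cons[g1Phi G1so _] := strongly_orthogonal_perm perm_g1 Gso.
have [_ G1Phi _] := G1so.
pose d := \sum_(g <- G1) coroot g a *: g.
have dPhi : d \in Phi.
  have := root_reflection aPhi g1Phi; rewrite /reflection ag1 mulrC -scalerA aE.
  rewrite (perm_big _ perm_g1) big_cons -/d scalerDr scalerA -expr2 e2 scale1r.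
  rewrite opprD addrA subrr sub0r root_opp => eds.
  by move: eds; have [->|->] := sqr_eq1 _ e2; rewrite ?scale1r // scaleN1r root_opp.
have f2 : (\sum_(g <- G1) coroot g a) ^+ 2 = 1.
  by apply: sqr_int_comb_sum => // g gG1; apply: coroot_int (G1Phi g gG1) aPhi.
rewrite (perm_big _ perm_g1) big_cons -/G1 -/e /=.
have [[->|->] [->|->]] := (sqr_eq1 _ e2, sqr_eq1 _ f2); apply/evenrP.
- by exists 1; ring.
- by exists 0; ring.
- by exists 0; ring.
- by exists (-1); ring.
Qed.

Lemma evenr_sum_coroot : evenr (\sum_(g <- G) coroot g a).
Proof.
have [_ GPhi _] := Gso.
pose exceptional g := (coroot g a ^+ 2 == 1) && (coroot a g == 2 * coroot g a).
have [/hasP[g1 g1G /andP[/eqP g1_sqr /eqP ag1]]|/hasPn regular_G] := boolP (has exceptional G).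
  exact: sum_coroot_exceptional g1G g1_sqr ag1.
have -> : \sum_(g <- G) coroot g a =
    4 - \sum_(g <- G) (coroot g a * coroot a g - coroot g a).
  by rewrite sumrB sum_coroot_mul; ring.
apply: evenrB; first by apply/evenrP; exists 2; ring.
apply: evenr_sum => g gG; have [//|[g_sqr ag]] := coroot_parity aPhi (GPhi g gG).
by have := regular_G g gG; rewrite /exceptional g_sqr ag !eqxx.
Qed.

End ParityOfCoroots.

Lemma exists_dual_vector (s : seq V) (t : V -> R) :
  free s -> exists y, {in s, forall a, '[a, y] = t a}.
Proof.
move=> s_free; pose n := size s.
pose A := \matrix_(i < n, j < n) '[s`_i, s`_j].
have A_unit : A \in unitmx.
  apply: (@gram_unitmx _ _ form _ (in_tuple s)) => // x _; by rewrite dot_gt0.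
pose z := invmx A *m \col_i t s`_i; exists (\sum_j z j 0 *: s`_j) => a.
rewrite -index_mem => lt_a; pose i : 'I_n := Ordinal lt_a.
have aE : s`_i = a by rewrite /= nth_index -?index_mem.
have /colP/(_ i) : A *m z = \col_i t s`_i by rewrite mulKVmx.
rewrite !mxE aE => <-; rewrite linear_sumr; apply: eq_bigr => j _.
by rewrite linearZr_LR /= mulrC -aE !mxE.
Qed.

Lemma positive_face_sum u v b : regular u ->
  {in Phi, forall a, 0 < '[a, u] -> 0 <= '[a, v]} -> positive u b -> '[b, v] = 0 ->
  exists c : V -> nat, b = \sum_(a <- simple_roots u | '[a, v] == 0) (c a)%:R *: a.
Proof.
move=> u_regular v_adj bpos bv0; have [c bE] := positive_simple_sum bpos.
have v_ge0 a : a \in simple_roots u -> 0 <= '[a, v].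
  by rewrite mem_simple_roots => /simple_positive/andP[/v_adj].
exists c; rewrite {1}bE [RHS]big_mkcond /= !big_seq; apply: eq_bigr => a a_simple.
case: ifPn => // av0; have /eqP : '[b, v] = 0 := bv0.
rewrite bE linear_sumlz big_seq psumr_eq0 => [/allP/(_ a a_simple)|a' /v_ge0 a'v_ge0].
  rewrite a_simple linearZl_LR /= mulf_eq0 (negPf av0) orbF pnatr_eq0 => /eqP->.
  by rewrite scale0r.
by rewrite linearZl_LR mulr_ge0.
Qed.

(* For a chamber whose closure contains a generic vector fixed by the involution,
   the negated roots form a standard parabolic subsystem. *)
Lemma negated_simple_sums w : {subset w <= Phi} -> involutive (reflections w) ->
  exists u, regular u /\ exists C : V -> V -> int,
    {in Phi, forall b, reflections w b = - b ->
       b = \sum_(a <- simple_roots u | reflections w a == - a) (C b a)%:~R *: a}.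
Proof.
move=> w_roots w_inv; have [v _ v_generic] := generic_fixed_vector w_roots w_inv.
have [u u_regular v_adj] := exists_adjacent_chamber v; exists u; split=> //.
have pos_sum b : positive u b -> reflections w b = - b -> exists c : V -> int,
    b = \sum_(a <- simple_roots u | reflections w a == - a) (c a)%:~R *: a.
  move=> bpos wb; have bv0 : '[b, v] = 0.
    by apply/eqP; rewrite v_generic ?wb // (positive_root bpos).
  have [c bE] := positive_face_sum u_regular v_adj bpos bv0.
  exists (fun a => c a : int); rewrite {1}bE big_seq_cond [RHS]big_seq_cond.
  apply: eq_bigl => a; apply: andb_id2l; rewrite mem_simple_roots => /simple_root aPhi.
  exact: v_generic.
suff /choice[C CE] : forall b, exists c : V -> int, b \in Phi -> reflections w b = - b ->
    b = \sum_(a <- simple_roots u | reflections w a == - a) (c a)%:~R *: a.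
  by exists C => b bPhi wb; apply: CE.
move=> b; have [[bPhi wb]|not_neg] := EM (b \in Phi /\ reflections w b = - b); last first.
  by exists (fun=> 0) => bPhi wb; case: not_neg.
have [/pos_sum/(_ wb)[c bE]|] := boolP (positive u b); first by exists c.
rewrite -positive_opp // => /pos_sum[|c bE]; first by rewrite linearN /= wb.
exists (fun a => - c a) => _ _; apply: oppr_inj; rewrite {1}bE -sumrN.
by apply: eq_bigr => a _; rewrite rmorphN scaleNr opprK.
Qed.

Section OddCoweight.
Variables (w G : seq V).
Hypothesis w_roots : {subset w <= Phi}.
Hypothesis w_inv : involutive (reflections w).
Hypothesis G_so : strongly_orthogonal G.
Hypothesis G_neg : {in G, forall g, reflections w g = - g}.
Hypothesis wE : forall x, reflections w x = x - \sum_(g <- G) coroot g x *: g.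

Lemma evenr_sum_coroot_negated a :
  a \in Phi -> reflections w a = - a -> evenr (\sum_(g <- G) coroot g a).
Proof.
move=> aPhi wa; apply: evenr_sum_coroot => //; apply/eqP.
by rewrite -[_ == _]subr_eq0 scaler_nat mulr2n -addrA -wE wa subrr.
Qed.

Lemma even_lattice_relation (J : seq V) (d q : V -> int) :
  {in J, forall a, a \in Phi /\ reflections w a = - a} ->
  \sum_(g <- G) (d g)%:~R *: g = 2 *: \sum_(a <- J) (q a)%:~R *: a ->
  (2 %| \sum_(g <- G) d g)%Z.
Proof.
set x := \sum_(a <- J) _ => J_neg dE.
have coroot_x g : g \in G -> coroot g x = (d g)%:~R.
  move=> gG; have := coroot_strongly_orthogonal_sum (fun g => (d g)%:~R) G_so gG.
  by rewrite dE linearZ /=; lra.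
rewrite -(evenr_int R) rmorph_sum /= big_seq.
under eq_bigr => g gG do rewrite -(coroot_x g gG) linear_sum /=.
rewrite -big_seq exchange_big /=; apply: evenr_sum => a aJ; have [aPhi wa] := J_neg a aJ.
under eq_bigr => g _ do rewrite linearZ /=.
by rewrite -mulr_sumr evenr_mulz ?evenr_sum_coroot_negated.
Qed.

(* Since g_i(y) may only be prescribed through the simple roots, solvability is
   an F_2-linear condition: a relation 2 x = sum_i d_i g_i with x in the span of
   the negated simple roots must have sum_i d_i = sum_i <x, g_i^v> even. *)
Lemma odd_coweight :
  exists y, {in Phi, forall a, '[a, y] \is a Num.int} /\ {in G, forall g, oddr '[g, y]}.
Proof.
have [u [u_regular [C CE]]] := negated_simple_sums w_roots w_inv.
have [G_uniq GPhi _] := G_so.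
pose J := [seq a <- simple_roots u | reflections w a == - a].
have J_neg : {in J, forall a, a \in Phi /\ reflections w a = - a}.
  by move=> a; rewrite mem_filter mem_simple_roots => /andP[/eqP wa /simple_root].
have GE g : g \in G -> g = \sum_(a <- J) (C g a)%:~R *: a.
  by move=> gG; rewrite big_filter -CE ?GPhi ?G_neg.
have [||d d_even|f f_odd] := @odd_system_solvable _ G J C; first exact: G_uniq.
- exact/filter_uniq/simple_roots_uniq.
- apply: (even_lattice_relation (q := fun a => (\sum_(g <- G) d g * C g a) %/ 2)%Z J_neg).
  rewrite scaler_sumr big_seq; under eq_bigr => g gG do rewrite {2}(GE g gG) scaler_sumr.
  rewrite -big_seq exchange_big /= !big_seq; apply: eq_bigr => a aJ.
  rewrite scalerA -(intrM R 2) mulrC divzK ?d_even // rmorph_sum scaler_suml.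
  by apply: eq_bigr => g _; rewrite scalerA rmorphM.
have [y yE] :=
  exists_dual_vector (fun a => (if a \in J then f a else 0)%:~R) (simple_roots_free u_regular).
have y_int a : simple u a -> '[a, y] \is a Num.int.
  by rewrite -mem_simple_roots => /yE->; apply: intr_int.
exists y; split=> [a aPhi|g gG].
  wlog apos : a aPhi / positive u a.
    move=> pos_int; have [/pos_int->//|] := boolP (positive u a).
    by rewrite -positive_opp // -rpredN -linearNl; apply: pos_int; rewrite root_opp.
  have [c ->] := positive_simple_sum apos.
  rewrite linear_sumlz big_seq rpred_sum // => b; rewrite mem_simple_roots => /y_int by_int.
  by rewrite linearZl_LR rpredM // ?natr_int.
suff -> : '[g, y] = (\sum_(a <- J) C g a * f a)%:~R by rewrite oddr_int f_odd.
rewrite {1}(GE g gG) linear_sumlz rmorph_sum /= !big_seq; apply: eq_bigr => a aJ.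
rewrite linearZl_LR rmorphM /= yE ?aJ //.
by move: aJ; rewrite mem_filter => /andP[].
Qed.

End OddCoweight.

End RootSystem.

(** * Automorphisms of Lie algebras *)

Section LieAlgebra.
Variables (R : realType) (L : vectType R) (br : L -> L -> L).
Hypothesis lieL : lie_algebra br.

Fact br_bilinear : bilinear_for *:%R *:%R br.
Proof. by have [linl linr _ _] := lieL; split=> z a x y /=; rewrite ?linl ?linr. Qed.
HB.instance Definition _ := bilinear_isBilinear.Build R L L L *:%R *:%R br br_bilinear.
HB.instance Definition _ x := GRing.isLinear.Build R L L *:%R (br x) (br_bilinear.2 x).

Lemma adE x y : ad br x y = br x y.
Proof. by rewrite lfunE. Qed.

Lemma brxx x : br x x = 0.
Proof. by case: lieL. Qed.

Lemma br_anti x y : br x y = - br y x.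
Proof.
apply/eqP; rewrite -addr_eq0; have := brxx (x + y).
by rewrite linearDl !linearDr /= !brxx add0r addr0 => ->.
Qed.

Lemma jacobi x y z : br x (br y z) = br (br x y) z + br y (br x z).
Proof.
have [_ _ _ jac] := lieL; apply/eqP; rewrite -subr_eq0 -(jac x y z).
by rewrite (br_anti z (br x y)) (br_anti z x) linearNr opprD addrA addrAC.
Qed.

Lemma automorphism_inj (f : 'End(L)) :
  (forall x, f x = 0 -> x = 0) -> {morph f : x y / br x y} -> automorphism br f.
Proof.
move=> f_ker f_br; split=> //; have f_inj : lker f == 0%VS.
  by rewrite -subv0; apply/subvP => x; rewrite memv_ker memv0 => /eqP/f_ker->.
by exists (f^-1)%VF; [apply: lker0_lfunK|apply: lker0_lfunVK].
Qed.

Lemma automorphism_id : automorphism br \1%VF.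
Proof. by split=> [|x y]; rewrite ?id_lfunE //; exists id => x; rewrite id_lfunE. Qed.

Lemma automorphism_comp f g :
  automorphism br f -> automorphism br g -> automorphism br (f \o g)%VF.
Proof.
move=> [f_bij f_br] [g_bij g_br]; split=> [|x y]; last by rewrite !comp_lfunE g_br f_br.
by apply: (eq_bij (bij_comp f_bij g_bij)) => x; rewrite /= comp_lfunE.
Qed.

Section NilpotentDerivation.
Variables (D : 'End(L)) (n : nat).
Hypothesis D_derivation : forall x y, D (br x y) = br (D x) y + br x (D y).
Hypothesis D_nilpotent : forall x, iter n D x = 0.

Definition divided_power k x : L := (k`!%:R)^-1 *: iter k D x.

Fact divided_power_linear k : linear (divided_power k).
Proof.
move=> a x y; rewrite /divided_power (_ : iter k D _ = a *: iter k D x + iter k D y).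
  by rewrite scalerDr !scalerA mulrC.
by elim: k => //= k ->; rewrite linearP.
Qed.
HB.instance Definition _ k :=
  GRing.isLinear.Build R L L *:%R (divided_power k) (divided_power_linear k).

Lemma divided_power0 x : divided_power 0 x = x.
Proof. by rewrite /divided_power /= invr1 scale1r. Qed.

Lemma divided_powerS k x : k.+1%:R *: divided_power k.+1 x = D (divided_power k x).
Proof.
rewrite /divided_power [RHS]linearZ /= scalerA factS natrM invfM mulrA mulfV ?mul1r //.
by rewrite pnatr_eq0.
Qed.

Lemma divided_powerSr k x : k.+1%:R *: divided_power k.+1 x = divided_power k (D x).
Proof.
rewrite /divided_power -iterSr scalerA factS natrM invfM mulrA mulfV ?mul1r //.
by rewrite pnatr_eq0.
Qed.

Lemma divided_power_ge k x : (n <= k)%N -> divided_power k x = 0.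
Proof.
by move=> /subnKC<-; rewrite /divided_power addnC iterD D_nilpotent iter_fix ?linear0 // scaler0.
Qed.

Lemma divided_power_br k x y : divided_power k (br x y) =
  \sum_(i < k.+1) br (divided_power i x) (divided_power (k - i) y).
Proof.
elim: k => [|k IHk]; first by rewrite big_ord1 !divided_power0.
apply: (@scalerI _ _ k.+1%:R); first by rewrite pnatr_eq0.
rewrite divided_powerS IHk linear_sum scaler_sumr /=.
under [LHS]eq_bigr => i _ do rewrite D_derivation -!divided_powerS.
have weights (i : 'I_k.+2) :
    k.+1%:R *: br (divided_power i x) (divided_power (k.+1 - i) y) =
    br (i%:R *: divided_power i x) (divided_power (k.+1 - i) y) +
    br (divided_power i x) ((k.+1 - i)%:R *: divided_power (k.+1 - i) y).
  rewrite [br (i%:R *: _) _]linearZl_LR [br _ (_%:R *: _)]linearZr_LR /=.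
  by rewrite -scalerDl -natrD subnKC // -ltnS.
under [RHS]eq_bigr => i _ do rewrite weights.
rewrite !big_split /=; congr (_ + _).
  by rewrite [RHS]big_ord_recl scale0r linear0l add0r.
rewrite [RHS]big_ord_recr /= subnn scale0r linear0r addr0.
by apply: eq_bigr => i _; rewrite subSn // -ltnS.
Qed.

Definition exp_derivation_fun x := \sum_(i < n) divided_power i x.

Fact exp_derivation_linear : linear exp_derivation_fun.
Proof.
by move=> a x y; rewrite scaler_sumr -big_split; apply: eq_bigr => i _; rewrite linearP.
Qed.
HB.instance Definition _ :=
  GRing.isLinear.Build R L L *:%R exp_derivation_fun exp_derivation_linear.

Definition exp_derivation : 'End(L) := linfun exp_derivation_fun.

Lemma exp_derivationE m x : (n <= m)%N -> exp_derivation x = \sum_(i < m) divided_power i x.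
Proof.
move=> /subnKC<-; rewrite lfunE /= big_split_ord /= [X in _ = _ + X]big1 ?addr0 // => i _.
by rewrite divided_power_ge // leq_addr.
Qed.

Lemma exp_derivation_br x y :
  exp_derivation (br x y) = br (exp_derivation x) (exp_derivation y).
Proof.
rewrite (exp_derivationE _ (leq_addr n n)).
under eq_bigr => k _ do rewrite divided_power_br.
rewrite (sum_antidiagonals (fun i j => br (divided_power i x) (divided_power j y))).
rewrite (exp_derivationE x (leq_addr n n)) linear_sumlz; apply: eq_bigr => i _.
have [n_le_i|lt_i_n] := leqP n i.
  by rewrite divided_power_ge // linear0l big1 // => j _; rewrite linear0l.
by rewrite -linear_sumr -exp_derivationE // -addnBA ?leq_addr // ltnW.
Qed.

Lemma exp_derivation_ker x : exp_derivation x = 0 -> x = 0.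
Proof.
have: iter n D x = 0 by [].
elim: {1}n x => // k IHk x; rewrite iterSr => Dkx expx0.
have Dx0 : D x = 0.
  apply: IHk Dkx _; rewrite -[RHS](linear0 D) -expx0 !lfunE /= linear_sum.
  by apply: eq_bigr => i _; rewrite -divided_powerSr divided_powerS.
rewrite -expx0 (exp_derivationE _ (leqnSn n)) big_ord_recl big1 ?addr0 ?divided_power0 // => i _.
by rewrite /divided_power lift0 iterSr Dx0 iter_fix ?linear0 // scaler0.
Qed.

Lemma exp_derivation_cubic x : D (D (D x)) = 0 -> exp_derivation x = x + D x + 2^-1 *: D (D x).
Proof.
move=> D3x; rewrite (exp_derivationE _ (leq_addl 3 n)) !big_ord_recl big1 => [|i _].
  by rewrite /divided_power /= !fact0 invr1 !scale1r addr0 addrA.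
by rewrite /divided_power !lift0 !iterSr D3x iter_fix ?linear0 // scaler0.
Qed.

End NilpotentDerivation.

Lemma exp_ad (x : L) (n : nat) (t : R) : (forall y, iter n (br x) y = 0) ->
  exists2 f : 'End(L), automorphism br f & forall y, br x (br x (br x y)) = 0 ->
    f y = y + t *: br x y + (t ^+ 2 / 2) *: br x (br x y).
Proof.
move=> x_nil; pose D := ad br (t *: x).
have DE y : D y = t *: br x y by rewrite adE linearZl_LR.
have D_nil y : iter n D y = 0.
  suff -> : iter n D y = t ^+ n *: iter n (br x) y by rewrite x_nil scaler0.
  by elim: (n) => [|k /= ->]; rewrite ?scale1r // DE linearZr_LR scalerA exprS.
have D_der y z : D (br y z) = br (D y) z + br y (D z) by rewrite !adE jacobi.
exists (exp_derivation D n) => [|y x3y].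
  exact: automorphism_inj (exp_derivation_ker D_nil) (exp_derivation_br D_der D_nil).
rewrite exp_derivation_cubic // !DE !linearZr_LR /= ?x3y ?scaler0 // !scalerA.
by congr (_ + _ *: _); field.
Qed.

(** * Gradings and the split real form *)

Definition ad_eigen (E : L) (m : int) (x : L) := br E x = m%:~R *: x.

(* The integer eigenspaces of ad E span L. *)
Definition ad_integral (E : L) := forall U : {vspace L},
  (forall m x, ad_eigen E m x -> x \in U) -> U = fullv.

Lemma ad_eigen_br E m k x y : ad_eigen E m x -> ad_eigen E k y -> ad_eigen E (m + k) (br x y).
Proof.
by move=> Ex Ey; rewrite /ad_eigen jacobi Ex Ey linearZl_LR linearZr_LR -scalerDl -intrD.
Qed.

Lemma automorphism_ad_integral f E : automorphism br f -> ad_integral E -> ad_integral (f E).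
Proof.
move=> [[g _ gK] f_br] E_int U U_eigen; apply/eqP; rewrite eqEsubv subvf; apply/subvP => y _.
have : g y \in (f @^-1: U)%VS; last by rewrite -memv_preim gK.
rewrite (E_int (f @^-1: U)%VS) ?memvf // => m x Ex; rewrite -memv_preim.
by apply: (U_eigen m); rewrite /ad_eigen -f_br Ex linearZ.
Qed.

Lemma ad_integral_lfun_eq E (f g : 'End(L)) : ad_integral E ->
  (forall m x, ad_eigen E m x -> f x = g x) -> f = g.
Proof.
move=> E_int fg; apply/lfunP => x; apply/eqP.
have : x \in lker (f - g).
  rewrite (E_int (lker (f - g))) ?memvf // => m y /fg fgy.
  by rewrite memv_ker add_lfunE opp_lfunE fgy subrr.
by rewrite memv_ker add_lfunE opp_lfunE subr_eq0.
Qed.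

Section GradedOperators.
Variables (E : L) (e : (\dim {:L}).-tuple L) (wt : 'I_(\dim {:L}) -> int).
Hypothesis e_basis : basis_of {:L} e.
Hypothesis e_eigen : forall i, ad_eigen E (wt i) e`_i.
Implicit Types c d : int -> R.

Definition graded_fun c x := \sum_i (c (wt i) * coord e i x) *: e`_i.

Fact graded_linear c : linear (graded_fun c).
Proof.
move=> a x y; rewrite scaler_sumr -big_split; apply: eq_bigr => i _ /=.
by rewrite linearP /= mulrDr scalerDl scalerA mulrCA.
Qed.
HB.instance Definition _ c := GRing.isLinear.Build R L L *:%R (graded_fun c) (graded_linear c).

(* The functional calculus c(ad E) *)
Definition graded c : 'End(L) := linfun (graded_fun c).

Lemma coord_graded c x i : coord e i (graded c x) = c (wt i) * coord e i x.
Proof. by rewrite lfunE /= coord_sum_free // (basis_free e_basis). Qed.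

Lemma ad_eigen_coord m x i : ad_eigen E m x -> coord e i x != 0 -> wt i = m.
Proof.
move=> Ex xi0; have : br E x = \sum_j (coord e j x * (wt j)%:~R) *: e`_j.
  rewrite [in LHS](coord_basis e_basis (memvf x)) linear_sumr; apply: eq_bigr => j _.
  by rewrite linearZr_LR /= e_eigen scalerA.
move=> /(congr1 (coord e i)); rewrite Ex linearZ /= coord_sum_free ?(basis_free e_basis) //.
by rewrite mulrC => /(mulfI xi0)/intr_inj.
Qed.

Lemma graded_eigen c m x : ad_eigen E m x -> graded c x = c m *: x.
Proof.
move=> Ex; apply: (coord_inj e_basis) => i; rewrite coord_graded linearZ /=.
by have [->|/(ad_eigen_coord Ex)->] := eqVneq (coord e i x) 0; rewrite ?mulr0.
Qed.

Lemma graded_br c x y : graded c (br x y) =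
  \sum_i \sum_j (coord e i x * coord e j y * c (wt i + wt j)) *: br e`_i e`_j.
Proof.
rewrite {1}(coord_basis e_basis (memvf x)) {1}(coord_basis e_basis (memvf y)).
rewrite linear_sumlz linear_sum; apply: eq_bigr => i _.
rewrite linear_sumr linear_sum; apply: eq_bigr => j _ /=.
rewrite linearZl_LR linearZr_LR /= !linearZ /=.
by rewrite (graded_eigen c (ad_eigen_br (e_eigen i) (e_eigen j))) !scalerA.
Qed.

Lemma br_graded c d x y : br (graded c x) (graded d y) =
  \sum_i \sum_j (coord e i x * coord e j y * (c (wt i) * d (wt j))) *: br e`_i e`_j.
Proof.
rewrite !lfunE /= linear_sumlz; apply: eq_bigr => i _.
rewrite linear_sumr; apply: eq_bigr => j _.
by rewrite linearZl_LR linearZr_LR /= scalerA; congr (_ *: _); ring.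
Qed.

Lemma graded_sign_involutive : involutive (graded sign_pow).
Proof.
by move=> x; apply: (coord_inj e_basis) => i; rewrite !coord_graded mulrA sign_pow_sqr mul1r.
Qed.

Lemma graded_sign_automorphism : automorphism br (graded sign_pow).
Proof.
split=> [|x y]; first by exists (graded sign_pow); apply: graded_sign_involutive.
rewrite graded_br br_graded; apply: eq_bigr => i _; apply: eq_bigr => j _.
by rewrite sign_powD.
Qed.

Lemma graded_re_sqr x : graded re_ipow (graded re_ipow x) = 2^-1 *: (x + graded sign_pow x).
Proof.
apply: (coord_inj e_basis) => i; rewrite linearZ linearD /= !coord_graded mulrA re_ipow_sqr.
by rewrite -mulrA mulrDl mul1r.
Qed.

Lemma graded_im_sqr x : graded im_ipow (graded im_ipow x) = 2^-1 *: (x - graded sign_pow x).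
Proof.
apply: (coord_inj e_basis) => i; rewrite linearZ linearB /= !coord_graded mulrA im_ipow_sqr.
by rewrite -mulrA mulrBl mul1r.
Qed.

Lemma graded_re_im x : graded re_ipow (graded im_ipow x) = 0.
Proof.
by apply: (coord_inj e_basis) => i; rewrite !coord_graded mulrA re_mul_im_ipow mul0r linear0.
Qed.

Lemma graded_im_re x : graded im_ipow (graded re_ipow x) = 0.
Proof.
by apply: (coord_inj e_basis) => i; rewrite !coord_graded mulrCA mulrA re_mul_im_ipow mul0r linear0.
Qed.

Lemma graded_sign_re x : graded sign_pow (graded re_ipow x) = graded re_ipow x.
Proof. by apply: (coord_inj e_basis) => i; rewrite !coord_graded mulrA sign_mul_re_ipow. Qed.

Lemma graded_sign_im x : graded sign_pow (graded im_ipow x) = - graded im_ipow x.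
Proof.
by apply: (coord_inj e_basis) => i; rewrite linearN /= !coord_graded mulrA sign_mul_im_ipow mulNr.
Qed.

Lemma graded_ipow_brC x y :
  (graded re_ipow (br x y), graded im_ipow (br x y)) =
  brC br (graded re_ipow x, graded im_ipow x) (graded re_ipow y, graded im_ipow y).
Proof.
rewrite /brC /= !graded_br !br_graded -sumrB -big_split; congr (_, _).
  apply: eq_bigr => i _; rewrite -sumrB; apply: eq_bigr => j _.
  by rewrite -scalerBl -mulrBr re_ipowD.
apply: eq_bigr => i _; rewrite -big_split; apply: eq_bigr => j _ /=.
by rewrite -scalerDl -mulrDr im_ipowD.
Qed.

Lemma graded_sign_split : iso_to_split br (graded sign_pow).
Proof.
have half (x : L) : x = 2^-1 *: (x + x).
  by rewrite -mulr2n -scaler_nat scalerA mulVf ?scale1r ?pnatr_eq0.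
exists (graded re_ipow), (graded im_ipow); split.
- have recover x : x = graded re_ipow (graded re_ipow x) + graded im_ipow (graded im_ipow x).
    by rewrite graded_re_sqr graded_im_sqr -scalerDr addrACA subrr addr0 -half.
  by move=> x y [re_eq im_eq]; rewrite (recover x) re_eq im_eq -recover.
- by move=> x; split; rewrite /= ?graded_sign_re ?graded_sign_im.
- move=> [p q] [/= p_fix q_anti]; exists (graded re_ipow p + graded im_ipow q).
  rewrite !linearD /= graded_re_im graded_im_re graded_re_sqr graded_im_sqr p_fix q_anti.
  by rewrite opprK addr0 add0r -!half.
- exact: graded_ipow_brC.
Qed.

End GradedOperators.

(* sigma is (-1)^(ad E), and i^(ad E) maps L isomorphically onto its real form. *)
Lemma grading_involution E : ad_integral E -> exists sigma : 'End(L),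
  [/\ automorphism br sigma, involutive sigma, iso_to_split br sigma &
      forall m x, ad_eigen E m x -> sigma x = sign_pow m *: x].
Proof.
move=> E_int; have [|e e_basis e_eigen] :=
    @basis_of_spanning _ _ (fun x => exists m, ad_eigen E m x).
  by move=> U U_eigen; apply: E_int => m x Ex; apply: U_eigen; exists m.
have /fin_all_exists[wt wtE] : forall i : 'I_(\dim {:L}), exists m, ad_eigen E m e`_i.
  by move=> i; apply: e_eigen; rewrite mem_nth ?size_tuple.
exists (graded e wt sign_pow); split.
- exact: graded_sign_automorphism wtE.
- exact: graded_sign_involutive.
- exact: graded_sign_split wtE.
- exact: graded_eigen wtE _.
Qed.

(** * Weight spaces and the Killing form *)

Section Functionals.
Variable h : {vspace L}.

Fact ev_bilinear : bilinear_for *%R *%R (@ev R L h).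
Proof.
split=> [x c a b|a c x y] /=; first by rewrite /ev add_lfunE scale_lfunE.
by rewrite /ev !linearP.
Qed.
HB.instance Definition _ :=
  bilinear_isBilinear.Build R (functional h) L R *%R *%R (@ev R L h) ev_bilinear.

Lemma functional_eq (a b : functional h) : {in h, ev a =1 ev b} -> a = b.
Proof. by move=> ab; apply/lfunP => x; have := ab _ (subvsP x); rewrite /ev vsvalK. Qed.

Lemma functional_neq (a b : functional h) : a != b -> exists2 H, H \in h & ev a H != ev b H.
Proof.
move=> ab; apply: contrapT => no_sep; case/eqP: ab; apply: functional_eq => H hH.
by apply/eqP; apply: contrapT => /negP abH; apply: no_sep; exists H.
Qed.

Lemma root_space_br (a b : functional h) x y :
  root_space br a x -> root_space br b y -> root_space br (a + b) (br x y).
Proof.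
move=> ax bx H hH; rewrite jacobi (ax H hH) (bx H hH) linearZl_LR linearZr_LR -scalerDl.
by rewrite linearDl.
Qed.

Lemma root_space_iter (a b : functional h) x y k : root_space br a x -> root_space br b y ->
  root_space br (b + k%:R *: a) (iter k (br x) y).
Proof.
move=> ax bx; elim: k => [|k IHk] /=; first by rewrite scale0r addr0.
by rewrite mulrS scalerDl scale1r addrCA; apply: root_space_br.
Qed.

(* T is a product of operators ad H - b(H). *)
Lemma weight_filter (a : functional h) (s : seq (functional h)) : a \notin s ->
  exists (T : 'End(L)) (c : functional h -> R), [/\ forall b y, root_space br b y -> T y = c b *: y,
    {in s, forall b, c b = 0} & c a != 0].
Proof.
elim: s => [_|b s IHs].
  by exists \1%VF, (fun=> 1); split=> // [b y _|]; rewrite ?oner_neq0 // id_lfunE scale1r.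
rewrite in_cons negb_or => /andP[ab /IHs[T [c [TE cs ca]]]].
have [H hH abH] := functional_neq ab.
exists ((ad br H - ev b H *: \1) \o T)%VF, (fun d => (ev d H - ev b H) * c d); split.
- move=> d y dy; rewrite comp_lfunE (TE _ _ dy) linearZ /= add_lfunE opp_lfunE scale_lfunE.
  by rewrite id_lfunE adE dy // -scalerBl scalerA mulrC.
- by move=> d; rewrite in_cons => /predU1P[->|/cs->]; rewrite ?subrr ?mul0r ?mulr0.
- by rewrite mulf_neq0 // subr_eq0.
Qed.

End Functionals.

Lemma semisimple_centerless x : semisimple br -> (forall y, br x y = 0) -> x = 0.
Proof.
move=> ssL x_central; apply/eqP; rewrite -memv0.
suff <- : <[x]>%VS = 0%VS by exact: memv_line.
apply: ssL => [y z /vlineP[k ->]|].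
  by rewrite linearZr_LR /= br_anti x_central oppr0 scaler0 mem0v.
exists 1%N; apply/eqP; rewrite -subv0 /=; apply/span_subvP => y.
case/allpairsP => -[u v] /= [/vbasis_mem/vlineP[k ->] _ ->].
by rewrite linearZl_LR /= x_central scaler0 mem0v.
Qed.

Section KillingForm.
Import passmx.

Local Notation ad_mx x := (mxof (vbasis {:L}) (vbasis {:L}) (ad br x)).

Lemma ad_mx_br x y : ad_mx (br x y) = ad_mx y *m ad_mx x - ad_mx x *m ad_mx y.
Proof.
rewrite -!(mxof_comp _ _ (vbasisP _)) -linearB; congr (mxof _ _ _); apply/lfunP => z.
by rewrite add_lfunE opp_lfunE !comp_lfunE !adE jacobi addrK.
Qed.

Lemma killing_mxtrace x y : killing br x y = \tr (ad_mx y *m ad_mx x).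
Proof. by rewrite /killing (mxof_comp _ _ (vbasisP _)). Qed.

Lemma killingC x y : killing br x y = killing br y x.
Proof. by rewrite !killing_mxtrace mxtrace_mulC. Qed.

Fact killing_bilinear : bilinear_for *%R *%R (killing br).
Proof.
have linl z : scalar (killing br ^~ z).
  move=> c x y; rewrite !killing_mxtrace -mxtraceZ -mxtraceD scalemxAr -mulmxDr.
  congr (\tr (_ *m _)); rewrite -linearP; congr (mxof _ _ _); apply/lfunP => t.
  by rewrite add_lfunE scale_lfunE !adE linearDl linearZl_LR.
by split=> // z c x y; rewrite /= !(killingC z) linl.
Qed.
HB.instance Definition _ := bilinear_isBilinear.Build R L L R *%R *%R (killing br) killing_bilinear.

Lemma killing_invariant x y z : killing br (br x y) z = killing br x (br y z).
Proof.
rewrite !killing_mxtrace !ad_mx_br mulmxBr mulmxBl !raddfB /= !mulmxA; congr (_ - _).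
by rewrite mxtrace_mulC mulmxA.
Qed.

Lemma killing_diagonal (e : (\dim {:L}).-tuple L) (c : 'I_(\dim {:L}) -> R) x :
  basis_of {:L} e -> (forall i : 'I_(\dim {:L}), br x e`_i = c i *: e`_i) ->
  killing br x x = \sum_i c i ^+ 2.
Proof.
move=> e_basis xe; rewrite /killing (mxtrace_mxof_basis _ (vbasisP _) e_basis).
apply: eq_bigr => i _; rewrite !mxE /= vecof_delta comp_lfunE !adE !xe linearZr_LR /= xe.
by rewrite scalerA linearZ /= coord_free ?(basis_free e_basis) // eqxx mulr1 expr2.
Qed.

End KillingForm.

(** * Split Cartan subalgebras and Chevalley systems *)

Section Chevalley.
Variables (h : {vspace L}) (X Hc : functional h -> L) (tau : 'End(L)).
Hypothesis ssL : semisimple br.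
Hypothesis cartan_h : cartan br h.
Hypothesis chev : chevalley br X Hc tau.
Local Notation root := (is_root br (h := h)).
Implicit Types a b g : functional h.

Lemma root_neq0 a : root a -> a != 0.
Proof. by case. Qed.

Lemma root_space_X a : root a -> root_space br a (X a).
Proof. by have [[X_root _] _ _ _ _] := chev => /X_root[]. Qed.

Lemma X_neq0 a : root a -> X a != 0.
Proof. by have [[X_root _] _ _ _ _] := chev => /X_root[]. Qed.

Lemma Hc_in a : root a -> Hc a \in h.
Proof. by have [[_ Hc_h] _ _ _ _] := chev; apply: Hc_h. Qed.

Lemma ev_Hc_int a b : root a -> root b -> ev a (Hc b) \is a Num.int.
Proof. by have [_ ev_int _ _ _] := chev => ra rb; apply/intrP/ev_int. Qed.

Lemma br_X_opp a : root a -> br (X a) (X (- a)) = - Hc a.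
Proof. by have [_ _ XX _ _] := chev; apply: XX. Qed.

Lemma ev_Hc a : root a -> ev a (Hc a) = 2.
Proof.
have [_ _ _ [HX _] _] := chev => ra; have [+ _] := HX a ra.
rewrite root_space_X ?Hc_in // => /eqP; rewrite -subr_eq0 -scalerBl scaler_eq0.
by rewrite (negPf (X_neq0 ra)) orbF subr_eq0 => /eqP.
Qed.

Lemma tau_cartan H : H \in h -> tau H = - H.
Proof. by have [_ _ _ _ [_ _ tau_h _]] := chev; apply: tau_h. Qed.

Lemma tau_br x y : tau (br x y) = br (tau x) (tau y).
Proof. by have [_ _ _ _ [[_ tau_br] _ _ _]] := chev; apply: tau_br. Qed.

Lemma tauK : involutive tau.
Proof. by have [_ _ _ _ [_ tauK _ _]] := chev. Qed.

Lemma tau_X a : root a -> tau (X a) = X (- a).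
Proof. by have [_ _ _ _ [_ _ _ tau_X]] := chev; apply: tau_X. Qed.

Lemma cartan_abelian H H' : H \in h -> H' \in h -> br H H' = 0.
Proof.
have [h_sub _ _] := cartan_h => hH hH'.
have := tau_cartan (h_sub _ _ hH hH'); rewrite tau_br !tau_cartan // linearNl linearNr opprK.
by move=> /eqP; rewrite -addr_eq0 -mulr2n -scaler_nat scaler_eq0 pnatr_eq0 => /eqP.
Qed.

Lemma root_space0_cartan H : H \in h -> root_space br (0 : functional h) H.
Proof. by move=> hH H' hH'; rewrite cartan_abelian // linear0l scale0r. Qed.

Lemma br_X_cartan a H : root a -> H \in h -> br (X a) H = - (ev a H *: X a).
Proof. by move=> ra hH; rewrite br_anti root_space_X. Qed.

Lemma rootN a : root a -> root (- a).
Proof.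
move=> [a0 [x [x0 ax]]]; split; first by rewrite oppr_eq0.
exists (tau x); split; first by apply: contra_neq x0 => x0; rewrite -(tauK x) x0 linear0.
move=> H hH; rewrite -[in LHS](tauK H) -tau_br (tau_cartan hH) linearNl /= (ax H hH).
by rewrite linearN linearZ /= linearNl scaleNr.
Qed.

Lemma Hc_opp a : root a -> Hc (- a) = - Hc a.
Proof.
move=> ra; have := br_X_opp (rootN ra).
by rewrite opprK br_anti br_X_opp // opprK => ->; rewrite opprK.
Qed.

Lemma finite_spanning_roots : exists s : seq (functional h),
  {in s, forall a, root a} /\ forall U : {vspace L}, (h <= U)%VS ->
    {in s, forall a, X a \in U} -> U = fullv.
Proof.
have [_ _ _ [_ X_span] _] := chev.
have [|e e_basis e_gen] := @basis_of_spanning _ L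
    (fun x => x \in h \/ exists2 a, root a & x = X a).
  move=> U U_gen; apply: X_span => [|a ra]; last by apply: U_gen; right; exists a.
  by apply/subvP => H hH; apply: U_gen; left.
have /choice[r rE] : forall x, exists a, x \in e -> x \notin h -> root a /\ x = X a.
  move=> x; have [/e_gen[hx|[a ra ->]]|xe] := boolP (x \in e); last by exists 0.
    by exists 0; rewrite hx.
  by exists a.
exists [seq r x | x <- e & x \notin h]; split=> [a /mapP[x + ->]|U hU XU].
  by rewrite mem_filter => /andP[x_nh xe]; have [] := rE x xe x_nh.
apply/eqP; rewrite eqEsubv subvf -(span_basis e_basis); apply/span_subvP => x xe.
have [hx|x_nh] := boolP (x \in h); first exact: subvP hU x hx.
by have [_ ->] := rE x xe x_nh; rewrite XU // map_f // mem_filter x_nh.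
Qed.

Definition root_seq : seq (functional h) := projT1 (cid finite_spanning_roots).

Lemma root_seq_root a : a \in root_seq -> root a.
Proof. by have [+ _] := projT2 (cid finite_spanning_roots); apply. Qed.

Lemma cartan_roots_span (U : {vspace L}) :
  {in h, forall H, H \in U} -> {in root_seq, forall a, X a \in U} -> U = fullv.
Proof.
move=> hU XU; have [_ span] := projT2 (cid finite_spanning_roots).
by apply: span => //; apply/subvP.
Qed.

Lemma root_space_filter a : a != 0 -> exists (T : 'End(L)) (c : R),
  [/\ c != 0, {in h, forall H, T H = 0}, {in root_seq, forall b, b != a -> T (X b) = 0} &
      forall x, root_space br a x -> T x = c *: x].
Proof.
move=> a0; have [|T [c [TE c_s ca]]] := @weight_filter h a [seq b <- 0 :: root_seq | b != a].
  by rewrite mem_filter eqxx.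
exists T, (c a); split=> // [H /root_space0_cartan hH|b b_root ba|x /TE //].
  by rewrite (TE _ _ hH) c_s ?scale0r // mem_filter eq_sym a0 mem_head.
rewrite (TE _ _ (root_space_X (root_seq_root b_root))) c_s ?scale0r //.
by rewrite mem_filter ba in_cons b_root orbT.
Qed.

Lemma root_space_eq0 a x : a != 0 -> a \notin root_seq -> root_space br a x -> x = 0.
Proof.
move=> a0 a_nroot ax; have [T [c [c0 T_h T_X Ta]]] := root_space_filter a0.
have : x \in lker T; last by rewrite memv_ker Ta // scaler_eq0 (negPf c0) => /eqP.
rewrite (cartan_roots_span (U := lker T)) ?memvf // => [H hH|b b_root]; rewrite memv_ker.
  by rewrite T_h.
by rewrite T_X //; apply: contraNneq a_nroot => <-.
Qed.

Lemma root_seqP a : reflect (root a) (a \in root_seq).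
Proof.
apply: (iffP idP) => [|[a0 [x [x0 ax]]]]; first exact: root_seq_root.
by apply: contraT => /(root_space_eq0 a0)/(_ ax) x_eq0; rewrite x_eq0 eqxx in x0.
Qed.

Lemma root_space_line a x : root a -> root_space br a x -> x \in <[X a]>%VS.
Proof.
move=> ra ax; have [T [c [c0 T_h T_X Ta]]] := root_space_filter (root_neq0 ra).
have : x \in (T @^-1: <[X a]>)%VS.
  rewrite (cartan_roots_span (U := (T @^-1: <[X a]>)%VS)) ?memvf // => [H hH|b b_root].
    by rewrite -memv_preim T_h ?mem0v.
  rewrite -memv_preim; have [->|ba] := eqVneq b a; last by rewrite T_X ?mem0v.
  by rewrite Ta ?memvZ ?memv_line //; apply: root_space_X.
by rewrite -memv_preim Ta // => /(memvZ c^-1); rewrite scalerA mulVf // scale1r.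
Qed.

Lemma br_X_eq0 a b : root a -> root b -> a + b != 0 -> a + b \notin root_seq -> br (X a) (X b) = 0.
Proof.
move=> ra rb ab0 ab_nroot; apply: root_space_eq0 ab0 ab_nroot _.
exact: root_space_br (root_space_X ra) (root_space_X rb).
Qed.

Lemma exists_root_string_end a b : a != 0 -> exists2 k, (k < (size root_seq).+2)%N &
  b + k%:R *: a \notin 0 :: root_seq.
Proof.
move=> a0; apply: contrapT => no_end.
have : (size [seq (b + k%:R *: a)%R | k <- iota 0 (size root_seq).+2] <= size (0%R :: root_seq))%N.
  apply: uniq_leq_size => [|_ /mapP[k + ->]]; last first.
    rewrite mem_iota add0n => lt_k; apply: contrapT => /negP out.
    by apply: no_end; exists k.
  rewrite map_inj_uniq ?iota_uniq // => i j /addrI/eqP.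
  by rewrite -subr_eq0 -scalerBl scaler_eq0 (negPf a0) orbF subr_eq0 eqr_nat => /eqP.
by rewrite size_map size_iota ltnn.
Qed.

Lemma ad_X_nilpotent a y : root a -> iter (size root_seq).+2 (br (X a)) y = 0.
Proof.
move=> ra; set n := (size root_seq).+2; pose T := iter n (fun f => ad br (X a) \o f)%VF \1%VF.
have TE z : T z = iter n (br (X a)) z.
  by rewrite /T; elim: (n) => [|k /= <-]; rewrite ?id_lfunE // comp_lfunE adE.
have T_weight b z : root_space br b z -> T z = 0.
  move=> bz; have [k] := exists_root_string_end b (root_neq0 ra); rewrite -/n => lt_k_n.
  rewrite in_cons negb_or => /andP[bk0 bk_nroot].
  have := root_space_eq0 bk0 bk_nroot (root_space_iter k (root_space_X ra) bz).
  by rewrite TE -(subnK (ltnW lt_k_n)) iterD => ->; rewrite iter_fix ?linear0r.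
rewrite -TE; apply/eqP; rewrite -memv_ker.
rewrite (cartan_roots_span (U := lker T)) ?memvf // => [H hH|b b_root]; rewrite memv_ker.
  by rewrite (T_weight 0) //; apply: root_space0_cartan.
by rewrite (T_weight b) //; apply/root_space_X/root_seq_root.
Qed.

(** * Cayley transforms *)

Lemma exp_X a (t : R) : root a -> exists2 f : 'End(L), automorphism br f &
  [/\ {in h, forall H, f H = H - (t * ev a H) *: X a},
      forall y, br (X a) y = 0 -> f y = y &
      f (X (- a)) = X (- a) - t *: Hc a + t ^+ 2 *: X a].
Proof.
move=> ra; have [f f_aut fE] := exp_ad t (fun y => ad_X_nilpotent y ra); exists f => //.
have quadratic y : br (X a) (br (X a) y) = 0 -> f y = y + t *: br (X a) y.
  by move=> X2y; rewrite fE X2y ?linear0r // scaler0 addr0.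
split=> [H hH|y Xy|].
- have XH := br_X_cartan ra hH.
  rewrite quadratic XH; first by rewrite scalerN scalerA.
  by rewrite linearNr linearZr_LR /= brxx scaler0 oppr0.
- by rewrite quadratic Xy ?linear0r // scaler0 addr0.
- have X2 : br (X a) (- Hc a) = 2 *: X a.
    by rewrite linearNr /= br_X_cartan ?Hc_in // ev_Hc // opprK.
  rewrite fE br_X_opp // X2; first by rewrite scalerN scalerA divfK // pnatr_eq0.
  by rewrite linearZr_LR /= brxx scaler0.
Qed.

Lemma exp_X_opp a (t : R) : root a -> exists2 f : 'End(L), automorphism br f &
  [/\ {in h, forall H, f H = H + (t * ev a H) *: X (- a)},
      forall y, br (X (- a)) y = 0 -> f y = y &
      f (X a) = X a + t *: Hc a + t ^+ 2 *: X (- a)].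
Proof.
move=> ra; have [f f_aut [f_h f_fix f_X]] := exp_X t (rootN ra).
exists f => //; split=> [H hH|//|]; first by rewrite f_h // linearNl mulrN scaleNr opprK.
by move: f_X; rewrite opprK Hc_opp // scalerN opprK.
Qed.

Lemma reflection_automorphism a : root a -> exists2 f : 'End(L), automorphism br f &
  {in h, forall H, f H = H - ev a H *: Hc a}.
Proof.
move=> ra; have [f f_aut [f_h f_fix _]] := exp_X 1 ra.
have [g g_aut [g_h _ g_X]] := exp_X_opp 1 ra.
exists (f \o (g \o f))%VF => [|H hH]; first by do !apply: automorphism_comp.
set c := ev a H; rewrite !comp_lfunE (f_h H hH) mul1r -/c.
have -> : g (H - c *: X a) = H - c *: Hc a - c *: X a.
  rewrite linearB linearZ /= (g_h H hH) g_X mul1r expr1n !scale1r -/c.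
  by rewrite [X a + Hc a + _]addrC (addrC (X a)) scalerDr addrKA scalerDr opprD addrA.
have hHc : H - c *: Hc a \in h by rewrite rpredB ?rpredZ ?Hc_in.
rewrite linearB /= [f (_ *: _)]linearZ /= (f_h _ hHc) f_fix ?brxx // mul1r.
rewrite linearBr linearZr_LR /= ev_Hc // -/c.
by rewrite (_ : c - c * 2 = - c) ?scaleNr ?opprK ?addrK //; ring.
Qed.

Lemma root_reflection_coroot a b : root a -> root b -> root (b - ev b (Hc a) *: a).
Proof.
move=> ra rb; have [f [[g fK _] f_br] f_h] := reflection_automorphism ra; split.
  apply: contraNneq (root_neq0 rb) => b_eq; have := congr1 (fun d => ev d (Hc a)) b_eq.
  rewrite linearBl linearZl_LR linear0l /= ev_Hc // => bHc0.
  have {bHc0} bHc0 : ev b (Hc a) = 0 by lra.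
  by rewrite -b_eq bHc0 scale0r subr0.
exists (f (X b)); split.
  by apply: contra_neq (X_neq0 rb) => fX0; rewrite -(fK (X b)) fX0 -[RHS]fK linear0.
move=> H hH; pose H' := H - ev a H *: Hc a.
have hH' : H' \in h by rewrite rpredB ?rpredZ ?Hc_in.
have fH' : f H' = H.
  rewrite f_h // linearBr linearZr_LR /= ev_Hc //.
  rewrite (_ : ev a H - ev a H * 2 = - ev a H); last by ring.
  by rewrite scaleNr opprK subrK.
rewrite -{1}fH' -f_br root_space_X // linearZ /=; congr (_ *: _).
by rewrite linearBr linearBl linearZl_LR linearZr_LR /= mulrC.
Qed.

Lemma double_not_root a : root a -> ~ root (2 *: a).
Proof.
move=> ra r2a; have [a0 X2a] := (root_neq0 ra, root_space_X r2a).
have not_r3a : ~ root (3 *: a).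
  move=> r3a; have /intrP[z zE] := ev_Hc_int ra r3a.
  have := ev_Hc r3a; rewrite linearZl_LR /= zE -(intrM R 3) => /(@intr_eq_nat _ _ 2); lia.
have up : br (X a) (X (2 *: a)) = 0.
  apply: br_X_eq0 => //; rewrite -{1}[a]scale1r -scalerDl (_ : 1 + 2 = 3 :> R); try by ring.
    by rewrite scaler_eq0 pnatr_eq0.
  exact/root_seqP.
have /vlineP[c down] : br (X (- a)) (X (2 *: a)) \in <[X a]>%VS.
  apply: root_space_line => //; have := root_space_br (root_space_X (rootN ra)) X2a.
  by rewrite scaler_nat mulr2n addrA addNr add0r.
have := jacobi (X a) (X (- a)) (X (2 *: a)).
rewrite up down linearZr_LR /= brxx scaler0 linear0r addr0 br_X_opp // linearNl /= X2a ?Hc_in //.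
rewrite linearZl_LR /= ev_Hc // => /esym/eqP.
by rewrite oppr_eq0 scaler_eq0 (negPf (X_neq0 r2a)) orbF mulf_eq0 pnatr_eq0.
Qed.

Lemma killing_gt0 H : H \in h -> H != 0 -> 0 < killing br H H.
Proof.
move=> hH H0; have [|e e_basis e_weight] :=
    @basis_of_spanning _ L (fun x => exists b, root_space br b x).
  move=> U U_weight; apply: cartan_roots_span => [H' hH'|a a_root]; apply: U_weight.
    by exists 0; apply: root_space0_cartan.
  by exists a; apply/root_space_X/root_seq_root.
have /fin_all_exists[wt wtE] : forall i : 'I_(\dim {:L}), exists b, root_space br b e`_i.
  by move=> i; apply: e_weight; rewrite mem_nth ?size_tuple.
have HE (i : 'I_(\dim {:L})) : br H e`_i = ev (wt i) H *: e`_i by apply: wtE.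
rewrite (killing_diagonal e_basis HE) lt0r sumr_ge0 ?andbT => [|i _]; last exact: sqr_ge0.
apply: contra H0; rewrite psumr_eq0 => [|i _]; last exact: sqr_ge0.
move=> /allP wtH0; apply/eqP/semisimple_centerless => // y.
rewrite (coord_basis e_basis (memvf y)) linear_sumr big1 // => i _.
have := wtH0 i (mem_index_enum i); rewrite /= sqrf_eq0 => /eqP wtiH0.
by rewrite linearZr_LR /= HE wtiH0 scale0r scaler0.
Qed.

Lemma gram_unit : gram br h \in unitmx.
Proof.
have -> : gram br h = \matrix_(i < \dim h, j < \dim h) killing br (vbasis h)`_i (vbasis h)`_j.
  by apply/matrixP => i j; rewrite !mxE !(tnth_nth 0).
apply: gram_unitmx; last exact: basis_free (vbasisP h).
by move=> H; rewrite (span_basis (vbasisP h)); apply: killing_gt0.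
Qed.

Definition killing_dual a : L :=
  \sum_i (invmx (gram br h) *m (coords a)^T) i 0 *: tnth (vbasis h) i.

Lemma killing_dual_in a : killing_dual a \in h.
Proof. by rewrite rpred_sum // => i _; rewrite rpredZ // vbasis_mem ?mem_tnth. Qed.

Lemma ev_killing_dual a b : ev a (killing_dual b) = inner br a b.
Proof.
rewrite /inner -mulmxA /killing_dual linear_sumr mxE; apply: eq_bigr => i _.
by rewrite linearZr_LR /= [in RHS]mxE mulrC.
Qed.

Lemma killing_killing_dual a H : H \in h -> killing br H (killing_dual a) = ev a H.
Proof.
have basis_case j : killing br (tnth (vbasis h) j) (killing_dual a) = ev a (tnth (vbasis h) j).
  have /colP/(_ j) := mulKVmx gram_unit (coords a)^T; rewrite mxE [RHS]mxE [RHS]mxE => <-.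
  rewrite linear_sumr; apply: eq_bigr => i _.
  by rewrite linearZr_LR /= [gram _ _ _ _]mxE mulrC.
move=> /coord_vbasis->; rewrite linear_sumlz linear_sumr; apply: eq_bigr => i _.
by rewrite linearZl_LR linearZr_LR /= -(tnth_nth 0) basis_case.
Qed.

Lemma innerC a b : inner br a b = inner br b a.
Proof.
rewrite -!ev_killing_dual -(killing_killing_dual a (killing_dual_in b)) killingC.
by rewrite killing_killing_dual ?killing_dual_in.
Qed.

Fact inner_bilinear : bilinear_for *%R (idfun \; *%R) (@inner R L br h).
Proof.
have linl c : scalar (fun a : functional h => inner br a c).
  by move=> d a b; rewrite -!ev_killing_dual linearPl.
by split=> // c d a b; rewrite /= !(innerC c) linl.
Qed.

Lemma inner_gt0 a : a != 0 -> 0 < inner br a a.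
Proof.
move=> a0; rewrite -ev_killing_dual -killing_killing_dual ?killing_dual_in //.
rewrite killing_gt0 ?killing_dual_in //; apply: contra_neq a0 => da0.
by apply: functional_eq => H hH; rewrite -killing_killing_dual // da0 linear0r linear0l.
Qed.

Fact inner_symmetric a b : inner br a b = (-1) ^+ false * idfun (inner br b a).
Proof. by rewrite mul1r innerC. Qed.

Definition killing_dot : {dot functional h for idfun} := HB.pack (@inner R L br h)
  (bilinear_isBilinear.Build R (functional h) (functional h) R *%R (idfun \; *%R)
     (@inner R L br h) inner_bilinear)
  (isHermitianSesquilinear.Build R (functional h) false idfun (@inner R L br h) inner_symmetric)
  (isDotProduct.Build R (functional h) (@inner R L br h) inner_gt0).

Lemma coroot_killing_dot a b : root a -> coroot killing_dot a b = ev b (Hc a).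
Proof.
move=> ra; pose c := - killing br (X a) (X (- a)).
have killing_Hc H : H \in h -> killing br H (Hc a) = c * ev a H.
  move=> hH; rewrite -[Hc a]opprK -br_X_opp // linearNr /= -killing_invariant root_space_X //.
  by rewrite linearZl_LR /= mulrC mulNr.
have Hc_dual : Hc a = c *: killing_dual a.
  apply/eqP; rewrite -subr_eq0; apply: contraT => /killing_gt0.
  have hd : Hc a - c *: killing_dual a \in h by rewrite rpredB ?rpredZ ?killing_dual_in ?Hc_in.
  rewrite (linearBr _ _ (Hc a)) linearZr_LR /= killing_Hc // killing_killing_dual //.
  by rewrite subrr ltxx => /(_ hd).
have a_gt0 := inner_gt0 (root_neq0 ra); have := ev_Hc ra.
rewrite Hc_dual !linearZr_LR /= !ev_killing_dual /coroot /= => <-.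
by field; rewrite gt_eqF.
Qed.

Lemma root_seq_system : root_system killing_dot root_seq.
Proof.
split=> [|a b /root_seqP ra /root_seqP rb|a b /root_seqP ra /root_seqP rb|a /root_seqP ra].
- by apply/root_seqP => /root_neq0/eqP.
- by apply/root_seqP; rewrite /reflection coroot_killing_dot //; apply: root_reflection_coroot.
- by rewrite coroot_killing_dot //; apply: ev_Hc_int.
- by apply/root_seqP/double_not_root.
Qed.

(* In the SL_2 of the root a, the conjugation taking diag(1,-1)/2 to the symmetric
   matrix with off-diagonal entries 1/2 *)
Lemma cayley_transform a : root a -> exists2 f : 'End(L), automorphism br f &
  {in h, forall H, f H = H - (ev a H / 2) *: Hc a + (ev a H / 2) *: (X a - X (- a))} /\
  forall y, br (X a) y = 0 -> br (X (- a)) y = 0 -> f y = y.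
Proof.
move=> ra; have [f f_aut [f_h f_fix _]] := exp_X (- 2^-1) ra.
have [g g_aut [g_h g_fix g_X]] := exp_X_opp (-1) ra.
exists (g \o f)%VF; first exact: automorphism_comp.
split=> [H hH|y Xy Xoy]; last by rewrite comp_lfunE f_fix // g_fix.
have fH : f H = H + (ev a H / 2) *: X a by rewrite f_h // mulNr scaleNr opprK mulrC.
have gH : g H = H - (ev a H / 2) *: X (- a) - (ev a H / 2) *: X (- a).
  by rewrite g_h // -addrA -opprD -scalerDl -splitr mulN1r scaleNr.
rewrite comp_lfunE fH linearD linearZ /= gH g_X sqrrN expr1n scaleN1r scale1r.
by rewrite !scalerDr !scalerN [LHS](AC (3*3) (1*5*(4*2)*(3*6))) /= addNr addr0.
Qed.

Section StronglyOrthogonalRoots.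
Variable G : seq (functional h).
Hypothesis G_so : strongly_orthogonal killing_dot root_seq G.

Lemma strongly_orthogonal_root g : g \in G -> root g.
Proof. by have [_ G_roots _] := G_so => /G_roots/root_seqP. Qed.

Lemma ev_Hc_orthogonal g g' : g \in G -> g' \in G -> g != g' -> ev g (Hc g') = 0.
Proof.
have [_ _ G_orth] := G_so => gG g'G gg'; have [o _ _] := G_orth g g' gG g'G gg'.
rewrite -coroot_killing_dot; first exact: coroot_orth.
exact: strongly_orthogonal_root.
Qed.

Lemma strongly_orthogonal_commute g g' : g \in G -> g' \in G -> g != g' ->
  {in [:: X g; X (- g)] & [:: X g'; X (- g')], forall x y, br x y = 0}.
Proof.
have [_ _ G_orth] := G_so => gG g'G gg'; have [o gg'_p gg'_m] := G_orth g g' gG g'G gg'.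
have [rg rg'] := (strongly_orthogonal_root gG, strongly_orthogonal_root g'G).
have root_oppE := root_opp root_seq_system.
have gm_neq0 : g - g' != 0 by rewrite subr_eq0.
have gp_neq0 : g + g' != 0.
  apply: contraTneq (root_neq0 rg) => /eqP; rewrite addr_eq0 => /eqP g_eq.
  have := ev_Hc_orthogonal g'G gG; rewrite eq_sym => /(_ gg').
  by rewrite g_eq Hc_opp // linearNr /= ev_Hc // => /eqP; rewrite oppr_eq0 pnatr_eq0.
have neg_m : - g + g' = - (g - g') by rewrite opprB addrC.
have neg_p : - g - g' = - (g + g') by rewrite opprD.
move=> x y; rewrite !inE => /orP[] /eqP-> /orP[] /eqP->; apply: br_X_eq0;
  rewrite ?neg_m ?neg_p ?oppr_eq0 ?root_oppE //; exact: rootN.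
Qed.

Definition orth_part H := H - \sum_(g <- G) (ev g H / 2) *: Hc g.

(* The image of H under the product of the Cayley transforms of the roots of G *)
Definition cayley_sum H := orth_part H + \sum_(g <- G) (ev g H / 2) *: (X g - X (- g)).

Lemma orth_part_in H : H \in h -> orth_part H \in h.
Proof.
move=> hH; rewrite rpredB // big_seq rpred_sum // => g gG.
exact/rpredZ/Hc_in/strongly_orthogonal_root.
Qed.

Lemma ev_orth_part g H : g \in G -> ev g (orth_part H) = 0.
Proof.
have [G_uniq _ _] := G_so => gG; rewrite linearBr linear_sumr (bigD1_seq g) //= big_seq_cond.
rewrite big1 => [|g' /andP[g'G g'g]].
  by rewrite linearZr_LR /= ev_Hc ?addr0; [lra|exact: strongly_orthogonal_root].
by rewrite linearZr_LR /= ev_Hc_orthogonal ?mulr0 // eq_sym.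
Qed.

Lemma tau_cayley_sum H : H \in h -> tau (cayley_sum H) = - cayley_sum H.
Proof.
move=> hH; rewrite /cayley_sum [RHS]opprD linearD /= tau_cartan ?orth_part_in //; congr (_ + _).
rewrite linear_sum /= -sumrN !big_seq; apply: eq_bigr => g /strongly_orthogonal_root rg.
by rewrite linearZ linearB /= !tau_X ?opprK -?scalerN ?opprB //; apply: rootN.
Qed.

Lemma ad_eigen_cayley_cartan H H' : H \in h -> H' \in h -> {in G, forall g, ev g H' = 0} ->
  ad_eigen (cayley_sum H) 0 H'.
Proof.
move=> hH hH' GH'; rewrite /ad_eigen scale0r linearDl /= cartan_abelian ?orth_part_in // add0r.
rewrite linear_sumlz big_seq big1 // => g gG; have rg := strongly_orthogonal_root gG.
rewrite linearZl_LR linearBl /= !br_X_cartan //; last exact: rootN.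
by rewrite linearNl /= GH' // oppr0 !scale0r subrr scaler0.
Qed.

(* The eigenvectors of X_g - X_{-g} in the sl_2 of g, for e = 1 and e = -1 *)
Lemma br_sl2_eigenvector g (e : R) : root g -> e ^+ 2 = 1 ->
  br (X g - X (- g)) (Hc g + e *: (X g + X (- g))) = (- 2 * e) *: (Hc g + e *: (X g + X (- g))).
Proof.
move=> rg e2; have rog := rootN rg.
have d_Hc : br (X g - X (- g)) (Hc g) = (- 2) *: (X g + X (- g)).
  rewrite linearBl /= !br_X_cartan ?Hc_in // linearNl /= ev_Hc // scaleNr opprK.
  by rewrite scalerDr !scaleNr.
have d_X : br (X g - X (- g)) (X g + X (- g)) = (- 2) *: Hc g.
  rewrite linearBl !linearDr /= !brxx (br_anti (X (- g))) br_X_opp //.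
  by rewrite add0r addr0 opprK -opprD -mulr2n -scaler_nat scaleNr.
rewrite linearDr linearZr_LR /= d_Hc d_X [RHS]scalerDr !scalerA addrC (mulrC e).
by rewrite -[_ * e * e]mulrA -expr2 e2 mulr1.
Qed.

Lemma ad_eigen_cayley_sl2 g H (e : R) (z m : int) : g \in G -> H \in h ->
  ev g H = z%:~R -> e ^+ 2 = 1 -> - e * z%:~R = m%:~R ->
  ad_eigen (cayley_sum H) m (Hc g + e *: (X g + X (- g))).
Proof.
move=> gG hH gHz e2 mE; have rg := strongly_orthogonal_root gG.
set y := Hc g + _.
have orth_y : br (orth_part H) y = 0.
  rewrite linearDr linearZr_LR linearDr /= cartan_abelian ?orth_part_in ?Hc_in //.
  rewrite !root_space_X ?orth_part_in //; last exact: rootN.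
  by rewrite linearNl /= ev_orth_part // oppr0 !scale0r addr0 scaler0 addr0.
have other_y g' : g' \in G -> g' != g -> br (X g' - X (- g')) y = 0.
  move=> g'G g'g; have comm := strongly_orthogonal_commute g'G gG g'g.
  have rg' := strongly_orthogonal_root g'G; have rog' := rootN rg'.
  rewrite linearDr linearZr_LR linearDr !linearBl /=.
  rewrite !(br_X_cartan _ (Hc_in rg)) // linearNl /= ev_Hc_orthogonal //.
  rewrite !comm ?inE ?eqxx ?orbT // oppr0 !scale0r oppr0.
  by rewrite !subrr !addr0 scaler0 addr0.
have [G_uniq _ _] := G_so.
rewrite /ad_eigen -mE linearDl /= orth_y add0r linear_sumlz (bigD1_seq g) //= big_seq_cond.
rewrite big1 => [|g' /andP[g'G g'g]]; last by rewrite linearZl_LR /= other_y // scaler0.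
by rewrite addr0 linearZl_LR /= br_sl2_eigenvector // scalerA gHz; congr (_ *: _); field.
Qed.

End StronglyOrthogonalRoots.

Lemma cayley_sum_automorphism G : strongly_orthogonal killing_dot root_seq G ->
  exists2 f : 'End(L), automorphism br f & {in h, f =1 cayley_sum G}.
Proof.
elim: G => [_|g G IHG gG_so].
  exists \1%VF => [|H _]; first exact: automorphism_id.
  by rewrite id_lfunE /cayley_sum /orth_part !big_nil subr0 addr0.
have [/root_seqP rg G_so g_orth] := (strongly_orthogonal_cons root_seq_system g G).1 gG_so.
have inG g' : g' \in G -> g' \in g :: G by rewrite in_cons orbC => ->.
have g_neq g' : g' \in G -> g != g'.
  by move=> g'G; have [/andP[gnG _] _ _] := gG_so; apply: contraNneq gnG => ->.
have [f f_aut fE] := IHG G_so; have [k k_aut [k_h k_fix]] := cayley_transform rg.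
exists (k \o f)%VF => [|H hH]; first exact: automorphism_comp.
have ev_g : ev g (orth_part G H) = ev g H.
  rewrite /orth_part linearBr linear_sumr big_seq big1 ?subr0 // => g' g'G.
  by rewrite linearZr_LR /= (ev_Hc_orthogonal gG_so) ?mulr0 ?mem_head ?inG ?g_neq.
have k_XG : k (\sum_(g' <- G) (ev g' H / 2) *: (X g' - X (- g'))) =
    \sum_(g' <- G) (ev g' H / 2) *: (X g' - X (- g')).
  rewrite linear_sum !big_seq; apply: eq_bigr => g' g'G /=.
  have comm := strongly_orthogonal_commute gG_so (mem_head g G) (inG _ g'G) (g_neq _ g'G).
  by rewrite k_fix // linearZr_LR linearBr /= !comm ?inE ?eqxx ?orbT // subrr scaler0.
rewrite comp_lfunE fE // /cayley_sum linearD /= k_h ?orth_part_in // ev_g k_XG.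
by rewrite /orth_part !big_cons opprD !addrA [H - _ - _]addrAC.
Qed.

Lemma foldr_refl (w : seq (functional h)) l :
  foldr (fun a f => refl br a \o f) id w l = reflections killing_dot w l.
Proof. by elim: w => //= a w ->. Qed.

Section Sigma.
Variables (G : seq (functional h)) (lam : L).
Hypothesis G_so : strongly_orthogonal killing_dot root_seq G.
Hypothesis lam_h : lam \in h.
Hypothesis lam_int : {in root_seq, forall a, ev a lam \is a Num.int}.
Hypothesis lam_odd : {in G, forall g, oddr (ev g lam)}.

Lemma ad_integral_cartan : ad_integral lam.
Proof.
move=> U U_eigen; apply: cartan_roots_span => [H hH|a a_root].
  by apply: (U_eigen 0); rewrite /ad_eigen cartan_abelian // scale0r.
have /intrP[z zE] := lam_int a_root; apply: (U_eigen z).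
by rewrite /ad_eigen -zE; apply: root_space_X lam_h; apply: root_seq_root.
Qed.

Lemma ad_integral_cayley_sum : ad_integral (cayley_sum G lam).
Proof.
have [f f_aut fE] := cayley_sum_automorphism G_so.
by rewrite -fE //; apply: automorphism_ad_integral f_aut ad_integral_cartan.
Qed.

Variable sigma : 'End(L).
Hypothesis sigma_eigen : forall m x, ad_eigen (cayley_sum G lam) m x -> sigma x = sign_pow m *: x.

Lemma sigma_tau x : sigma (tau x) = tau (sigma x).
Proof.
suff st : (sigma \o tau = tau \o sigma)%VF by rewrite -!comp_lfunE st.
apply: (ad_integral_lfun_eq ad_integral_cayley_sum) => m {}x Ex.
have Etx : ad_eigen (cayley_sum G lam) (- m) (tau x).
  have := congr1 tau Ex; rewrite tau_br tau_cayley_sum // linearNl linearZ /= => /eqP.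
  by rewrite eqr_oppLR -scaleNr -intrN => /eqP.
by rewrite !comp_lfunE (sigma_eigen Ex) (sigma_eigen Etx) sign_powN linearZ.
Qed.

Lemma sigma_Hc g : g \in G -> sigma (Hc g) = - Hc g.
Proof.
move=> gG; have /oddrP[z zE] := lam_odd gG.
pose y (e : R) := Hc g + e *: (X g + X (- g)).
have sigma_y (e : int) : e = 1 \/ e = -1 -> sigma (y e%:~R) = - y e%:~R.
  move=> e1; have e2 : (e%:~R : R) ^+ 2 = 1 by case: e1 => ->; ring.
  have yE : ad_eigen (cayley_sum G lam) (- e * (2 * z + 1)) (y e%:~R).
    by apply: ad_eigen_cayley_sl2 zE e2 _; rewrite // intrM intrN.
  by rewrite (sigma_eigen yE) sign_pow_odd ?scaleN1r //; case: e1 => ->; lia.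
have Hc_y : Hc g = 2^-1 *: (y 1%:~R + y (-1)%:~R).
  rewrite /y addrACA -scalerDl -intrD scale0r addr0 -mulr2n -scaler_nat scalerA.
  by rewrite mulVf ?scale1r // pnatr_eq0.
by rewrite Hc_y linearZ linearD /= !sigma_y; auto; rewrite -opprD scalerN.
Qed.

Lemma sigma_cartan H : H \in h -> sigma H = H - \sum_(g <- G) ev g H *: Hc g.
Proof.
move=> hH; have orth_fixed : sigma (orth_part G H) = orth_part G H.
  have: ad_eigen (cayley_sum G lam) 0 (orth_part G H).
    apply: ad_eigen_cayley_cartan => //; first exact: orth_part_in.
    by move=> g; apply: ev_orth_part.
  by move=> /sigma_eigen->; rewrite scale1r.
have sumN : sigma (\sum_(g <- G) (ev g H / 2) *: Hc g) = - \sum_(g <- G) (ev g H / 2) *: Hc g.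
  rewrite linear_sum -sumrN !big_seq; apply: eq_bigr => g gG /=.
  by rewrite linearZ /= sigma_Hc // scalerN.
rewrite -{1}(subrK (\sum_(g <- G) (ev g H / 2) *: Hc g) H) linearD /= orth_fixed sumN.
rewrite /orth_part -addrA -opprD -big_split; congr (_ - _); apply: eq_bigr => g _ /=.
by rewrite -scalerDl -splitr.
Qed.

End Sigma.

Lemma inv_tau_commute (sigma : 'End(L)) : automorphism br sigma -> involutive sigma ->
  {in h, forall H, sigma H \in h} -> (forall x, sigma (tau x) = tau (sigma x)) ->
  inv_tau br h tau sigma.
Proof.
move=> s_aut sK s_h st; split=> //.
  apply/eqP; rewrite eqEsubv; apply/andP; split; apply/subvP => H.
    by case/memv_imgP => H' hH' ->; apply: s_h.
  by move=> hH; rewrite -(sK H) memv_img // s_h.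
have s_form p : real_form tau p -> real_form tau (extC sigma p).
  case: p => p1 p2 [/= p1_fix p2_anti].
  by split; rewrite /= ?linearN /= -st ?p1_fix ?p2_anti ?linearN.
move=> q; split=> [q_form|[p [p_form <-]]]; last exact: s_form.
exists (extC sigma q); split; first exact: s_form.
by case: q {q_form} => q1 q2; rewrite /extC /= linearN /= !sK opprK.
Qed.

Lemma cayley_involution G lam :
  strongly_orthogonal killing_dot root_seq G -> lam \in h ->
  {in root_seq, forall a, ev a lam \is a Num.int} -> {in G, forall g, oddr (ev g lam)} ->
  exists sigma : 'End(L), [/\ inv_tau br h tau sigma, iso_to_split br sigma, involutive sigma &
    {in h, forall H, sigma H = H - \sum_(g <- G) ev g H *: Hc g}].
Proof.
move=> G_so lam_h lam_int lam_odd.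
have [sigma [s_aut sK s_split s_eigen]] :=
  grading_involution (ad_integral_cayley_sum G_so lam_h lam_int).
have s_cartan : {in h, forall H, sigma H = H - \sum_(g <- G) ev g H *: Hc g}.
  by move=> H; apply: sigma_cartan lam_odd _ s_eigen _.
exists sigma; split=> //.
apply: inv_tau_commute => // [H hH|]; last exact: (sigma_tau G_so lam_h lam_int s_eigen).
rewrite s_cartan // rpredB // big_seq rpred_sum // => g gG.
exact/rpredZ/Hc_in/(strongly_orthogonal_root G_so).
Qed.

Lemma rho_cayley (G : seq (functional h)) (sigma : 'End(L)) (s : 'End(functional h)) :
  {subset G <= root_seq} -> involutive sigma ->
  {in h, forall H, sigma H = H - \sum_(g <- G) ev g H *: Hc g} ->
  (forall l, s l = l - \sum_(g <- G) coroot killing_dot g l *: g) -> rho_eq sigma s.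
Proof.
move=> G_roots sigmaK sigma_h sE a H hH; rewrite involutive_invlf // sE sigma_h //.
rewrite linearBl linearBr linear_sumlz linear_sumr; congr (_ - _).
rewrite !big_seq; apply: eq_bigr => g /G_roots/root_seqP rg.
by rewrite linearZl_LR linearZr_LR /= coroot_killing_dot // mulrC.
Qed.

End Chevalley.

End LieAlgebra.

Theorem theorem3p13 (R : realType) (L : vectType R) (br : L -> L -> L)
    (h : {vspace L}) (X Hc : functional h -> L) (tau : 'End(L))
    (s : 'End(functional h)) :
  lie_algebra br -> semisimple br -> cartan br h ->
  chevalley br X Hc tau ->
  in_I br s -> in_weyl br s ->
  exists sigma : 'End(L),
    inv_tau br h tau sigma /\ rho_eq sigma s /\ iso_to_split br sigma.
Proof.
move=> lieL ssL cartan_h chev [sK _ _] [w [w_root sE]].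
pose form := killing_dot lieL ssL cartan_h chev.
have PhiP : root_system form (root_seq chev) := root_seq_system lieL ssL cartan_h chev.
have w_roots : {subset w <= root_seq chev} by move=> a /w_root/(root_seqP lieL cartan_h chev).
have sw l : s l = reflections form w l by rewrite sE -foldr_refl.
have w_inv : involutive (reflections form w) by move=> l; rewrite -!sw sK.
have [G [G_so G_neg wE]] := weyl_involution_strongly_orthogonal PhiP w_roots w_inv.
have [y [y_int y_odd]] := odd_coweight PhiP w_roots w_inv G_so G_neg wE.
have [||sigma [sigma_inv sigma_split sigmaK sigma_h]] :=
  cayley_involution G_so (killing_dual_in br y).
- by move=> a /y_int; rewrite ev_killing_dual.
- by move=> g /y_odd; rewrite ev_killing_dual.
have G_roots : {subset G <= root_seq chev} by have [] := G_so.
exists sigma; split=> //; split=> //.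
by apply: (rho_cayley G_roots sigmaK sigma_h) => l; rewrite sw wE.
Qed.
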